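(* Consider the radial compressible Euler equations in $n>1$ dimensions. For any equation of state $p=p(\rho,S)$, and with $J_l=\big((r^{1-n}/\rho)D_r\big)^lS$ for $l=0,1,2,\ldots$, $$\mathcal I_l=\int_{V(t)}\rho\, f(J_0,J_1,\ldots,J_l)\,r^{n-1}dr$$ is an integral invariant of order $l\ge1$ if $f$ is non-constant in its last argument. It is non-trivial at order $l$ if and only if $f$ is nonlinear in its last argument, namely $f_{J_lJ_l}\not\equiv0$.
   Context: Radial Euler equations: for functions $U(r,t)$ (radial velocity), $\rho(r,t)$ (density), $S(r,t)$ (entropy), with $r>0$ the radial coordinate in $\mathbb{R}^n$, $$U_t+UU_r+(p_S S_r+p_\rho\rho_r)/\rho=0,\quad \rho_t+(U\rho)_r+\tfrac{n-1}{r}U\rho=0,\quad S_t+US_r=0,$$ with equation of state $p=p(\rho,S)$. $D_r$ is the total $r$-derivative, acting by the chain rule on the fluid variables and their derivatives. A transported radial domain $V(t)$ is a radial interval whose endpoints $r_i(t)$ move with the flow, $dr_i/dt=U(r_i(t),t)$. An integral $\int_{V(t)}\Phi^t\,r^{n-1}dr$ is an integral invariant if its time derivative vanishes on all solutions for every transported radial domain; its order is the order of the highest $r$-derivative of the fluid variables in $\Phi^t$. A density $\Phi^t$ is locally trivial if $r^{n-1}\Phi^t=D_r(r^{n-1}\Theta)$ for some function $\Theta$ of $t,r$, the fluid variables and finitely many of their $r$-derivatives. ''Non-trivial at order $l$'' means that the density is not locally trivial modulo terms of order less than $l$, i.e. it is not equal to a locally trivial density plus a density of order less than $l$. *)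

(* Defs.v *)
From HB Require Import structures.
From Stdlib Require Import Reals.
From mathcomp Require Import ssreflect ssrfun ssrbool eqtype ssrnat seq fintype.
From Coquelicot Require Import Coquelicot.

Set Implicit Arguments.
Unset Strict Implicit.
Unset Printing Implicit Defensive.

Local Open Scope R_scope.

(** * Smooth functions of coordinates indexed by [I] *)

Definition upd (I : eqType) (z : I -> R) (i : I) (x : R) : I -> R :=
  fun j => if j == i then x else z j.

Definition pd (I : eqType) (i : I) (F : (I -> R) -> R) : (I -> R) -> R :=
  fun z => Derive (fun x => F (upd z i x)) (z i).

Definition pds (I : eqType) (w : seq I) (F : (I -> R) -> R) : (I -> R) -> R :=
  foldr (@pd I) F w.

(* [continuous] refers to the uniform distance on [I -> R]; for functions of
   finitely many coordinates this is the usual topology.  [D] is meant to be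
   open for that distance. *)
Definition smooth_on (I : eqType) (D : (I -> R) -> Prop) (F : (I -> R) -> R) :
    Prop :=
  forall (w : seq I) (z : I -> R), D z ->
    continuous (pds w F) z /\
    forall i : I, ex_derive (fun x => pds w F (upd z i x)) (z i).

(** * Jet space of the fluid variables *)

Inductive fluid : Set := Vel | Dens | Entr.

(* [Jet v k] is the [k]-th r-derivative of the fluid variable [v]. *)
Inductive coord : Set := Time | Radius | Jet (v : fluid) (k : nat).

Lemma coord_eq_dec (x y : coord) : {x = y} + {x <> y}.
Proof. by do 2!decide equality. Defined.

HB.instance Definition _ := hasDecEq.Build coord (compareP coord_eq_dec).

Definition jet_point := coord -> R.

Definition jet_dom (z : jet_point) : Prop := 0 < z Radius /\ 0 < z (Jet Dens 0).

Definition coord_order (c : coord) : nat :=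
  match c with Time | Radius => 0%nat | Jet _ k => k end.

Definition order_le (k : nat) (Phi : jet_point -> R) : Prop :=
  forall z z' : jet_point, jet_dom z -> jet_dom z' ->
    (forall c : coord, (coord_order c <= k)%nat -> z c = z' c) ->
    Phi z = Phi z'.

Definition has_order (k : nat) (Phi : jet_point -> R) : Prop :=
  order_le k Phi /\ forall j : nat, order_le j Phi -> (k <= j)%nat.

Definition order_lt (l : nat) (Phi : jet_point -> R) : Prop :=
  exists2 k : nat, (k < l)%nat & order_le k Phi.

(* Smooth functions of t, r, the fluid variables and finitely many of their
   r-derivatives. *)
Definition differential_function (Phi : jet_point -> R) : Prop :=
  smooth_on jet_dom Phi /\ exists N : nat, order_le N Phi.

(* For a differential function all but finitely many terms of the series
   vanish. *)
Definition Dr (Phi : jet_point -> R) : jet_point -> R := fun z =>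
  pd Radius Phi z +
  Series (fun k => z (Jet Vel k.+1) * pd (Jet Vel k) Phi z
                 + z (Jet Dens k.+1) * pd (Jet Dens k) Phi z
                 + z (Jet Entr k.+1) * pd (Jet Entr k) Phi z).

(** * Radial Euler equations and integral invariants *)

(* [p] has first argument the density and second argument the entropy. *)
Definition equation_of_state (p : R -> R -> R) : Prop :=
  forall rho s : R, 0 < rho -> ex_diff_n p 1 rho s.

Definition smooth_at (G : R -> R -> R) (r t : R) : Prop :=
  forall m : nat, ex_diff_n G m r t.

(* The fluid variables are functions of (r, t), in this order, on an open
   region [O] of the (r, t) half-plane r > 0. *)
Definition radial_euler (n : nat) (p : R -> R -> R) (O : R * R -> Prop)
    (U rho S : R -> R -> R) : Prop :=
  open O /\
  forall r t : R, O (r, t) ->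
    [/\ 0 < r, 0 < rho r t &
        [/\ smooth_at U r t, smooth_at rho r t & smooth_at S r t]] /\
    let p_rho := Derive (fun x => p x (S r t)) (rho r t) in
    let p_S := Derive (fun x => p (rho r t) x) (S r t) in
    [/\ Derive (fun t' => U r t') t + U r t * Derive (fun r' => U r' t) r
        + (p_S * Derive (fun r' => S r' t) r
           + p_rho * Derive (fun r' => rho r' t) r) / rho r t = 0,
        Derive (fun t' => rho r t') t
        + Derive (fun r' => U r' t * rho r' t) r
        + (INR n - 1) / r * (U r t * rho r t) = 0 &
        Derive (fun t' => S r t') t + U r t * Derive (fun r' => S r' t) r = 0].

Definition jet (U rho S : R -> R -> R) (r t : R) : jet_point := fun c =>
  match c with
  | Time => t
  | Radius => r
  | Jet Vel k => Derive_n (fun r' => U r' t) k r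
  | Jet Dens k => Derive_n (fun r' => rho r' t) k r
  | Jet Entr k => Derive_n (fun r' => S r' t) k r
  end.

(* The radial domain [r1 t, r2 t], for a < t < b, lies in [O] and moves with
   the flow. *)
Definition transported (O : R * R -> Prop) (U : R -> R -> R) (a b : R)
    (r1 r2 : R -> R) : Prop :=
  forall t : R, a < t < b ->
    [/\ r1 t < r2 t,
        (forall r : R, r1 t <= r <= r2 t -> O (r, t)),
        is_derive r1 t (U (r1 t) t) &
        is_derive r2 t (U (r2 t) t)].

Definition integral_invariant (n : nat) (p : R -> R -> R)
    (Phi : jet_point -> R) : Prop :=
  differential_function Phi /\
  forall (O : R * R -> Prop) (U rho S : R -> R -> R),
    radial_euler n p O U rho S ->
  forall (a b : R) (r1 r2 : R -> R), transported O U a b r1 r2 ->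
  forall t : R, a < t < b ->
    is_derive (fun t' => RInt (fun r => Phi (jet U rho S r t') * r ^ (n - 1))
                              (r1 t') (r2 t')) t 0.

(** * Triviality *)

Definition locally_trivial (n : nat) (Phi : jet_point -> R) : Prop :=
  exists2 Theta : jet_point -> R, differential_function Theta &
    forall z : jet_point, jet_dom z ->
      z Radius ^ (n - 1) * Phi z
      = Dr (fun y => y Radius ^ (n - 1) * Theta y) z.

Definition nontrivial_at_order (n l : nat) (Phi : jet_point -> R) : Prop :=
  ~ exists Phi0 Psi : jet_point -> R,
      [/\ locally_trivial n Phi0,
          differential_function Psi /\ order_lt l Psi &
          forall z : jet_point, jet_dom z -> Phi z = Phi0 z + Psi z].

(** * The densities *)

Fixpoint J (n l : nat) : jet_point -> R :=
  match l with
  | O => fun z => z (Jet Entr 0)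
  | S l' => fun z =>
      / z Radius ^ (n - 1) / z (Jet Dens 0) * Dr (J n l') z
  end.

Definition I_density (n l : nat) (f : ('I_l.+1 -> R) -> R) : jet_point -> R :=
  fun z => z (Jet Dens 0) * f (fun i => J n i z).

(* Main.v *)
(* The densities. Along a solution the functions [J_i] satisfy [J_t + U J_r = 0]: this
   holds for the entropy, and is preserved by [(r^(1-n)/rho) D_r] because the mass
   density [m = r^(n-1) rho] satisfies [m_t + (U m)_r = 0].  Hence [m f(J)] is a
   conserved density with flux [U m f(J)], and the Leibniz rule for a domain moving
   with the flow gives the invariance.

   Triviality. If [r^(n-1) rho f(J) - r^(n-1) Psi = D_r T] with [Psi] of order [< l],
   then [T] has order [< l], since [D_r] raises every positive order by exactly one;
   so the left side is affine in the top entropy derivative [S_l].  As [J_l] is affine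
   in [S_l] with nonzero slope, [f] is affine in its last argument.  Conversely, if
   [f = A + B J_l] with [A], [B] functions of [J_0, ..., J_(l-1)], a primitive [H] of [B]
   with respect to [J_(l-1)] satisfies [D_r (H(J)) = m B J_l + (terms of order < l)]. *)

Require Import Defs.
From Stdlib Require Import Reals Lra FunctionalExtensionality Classical IndefiniteDescription.
From mathcomp Require Import ssreflect ssrfun ssrbool eqtype ssrnat seq fintype.
From Coquelicot Require Import Coquelicot.

Set Implicit Arguments.
Unset Strict Implicit.
Unset Printing Implicit Defensive.

Local Open Scope R_scope.

(** * Finite sums *)

(** Jet space has infinitely many coordinates and carries the uniform distance, for which a curve
    with differentiable coordinates need not be continuous. Chain rule and composition are therefore
    proved for functions supported on a finite list of coordinates, all others being frozen.
    Smoothness speaks of all iterated partial derivatives; to avoid formulas for these, the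
    substantial smoothness proofs exhibit a class of C1 functions closed under [pd].

    The function [f] lives on all of R^(l+1), whereas the density sees only values of the [J_i].
    Nothing is lost: [J_i] contains S_i with nonzero slope, so the system J_0 = x_0, ..., J_l = x_l
    is triangular in the entropy jets and always solvable.

    Both directions of the triviality criterion use [l >= 1]: the potential [T] must have an order
    below [l], and the primitive is taken in [J_(l-1)]. *)

Definition Rsum (A : Type) (s : seq A) (F : A -> R) : R :=
  foldr (fun a x => F a + x) 0 s.

Lemma eq_Rsum (A : eqType) (s : seq A) (F G : A -> R) :
  {in s, F =1 G} -> Rsum s F = Rsum s G.
Proof.
elim: s => [|a s IH] //= FG.
rewrite FG ?mem_head // IH // => b sb.
by apply: FG; rewrite in_cons sb orbT.
Qed.

Lemma Rsum_eq0 (A : eqType) (s : seq A) (F : A -> R) :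
  {in s, forall a, F a = 0} -> Rsum s F = 0.
Proof.
move=> F0; rewrite (@eq_Rsum _ s F (fun _ => 0)) //.
by elim: s {F0} => //= a s ->; lra.
Qed.

Lemma Rsum_single (A : eqType) (s : seq A) (F : A -> R) (a : A) :
  uniq s -> a \in s -> {in s, forall b, b != a -> F b = 0} -> Rsum s F = F a.
Proof.
elim: s => [|b s IH] //= /andP[nbs us]; rewrite in_cons.
case: (eqVneq a b) nbs => [<- nas _ F0 | nab _ /= sa F0].
  rewrite Rsum_eq0 ?Rplus_0_r // => c sc; apply: F0.
    by rewrite in_cons sc orbT.
  by apply/negP => /eqP ca; move: nas; rewrite -ca sc.
rewrite F0 ?mem_head 1?eq_sym // IH // ?Rplus_0_l // => c sc.
by apply: F0; rewrite in_cons sc orbT.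
Qed.

Lemma Rsum_plus (A : Type) (s : seq A) (F G : A -> R) :
  Rsum s (fun a => F a + G a) = Rsum s F + Rsum s G.
Proof. by elim: s => [|a s IH] /=; [lra | rewrite IH; lra]. Qed.

Lemma Rsum_mulr (A : Type) (s : seq A) (F : A -> R) (x : R) :
  Rsum s (fun a => F a * x) = Rsum s F * x.
Proof. by elim: s => [|a s IH] /=; [lra | rewrite IH; lra]. Qed.

Lemma Rsum_minus (A : Type) (s : seq A) (F G : A -> R) :
  Rsum s (fun a => F a - G a) = Rsum s F - Rsum s G.
Proof. by elim: s => [|a s IH] /=; [lra | rewrite IH; lra]. Qed.

Lemma exchange_Rsum (A B : Type) (s : seq A) (t : seq B) (F : A -> B -> R) :
  Rsum s (fun a => Rsum t (F a)) = Rsum t (fun b => Rsum s (F^~ b)).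
Proof.
elim: s => [|a s IH] /=; last by rewrite IH -Rsum_plus.
by elim: t => [|b t IH] //=; rewrite -IH; lra.
Qed.

(** * Updating one coordinate *)

Section Coordinates.
Variable I : eqType.
Implicit Types (z : I -> R) (i j : I) (D : (I -> R) -> Prop).

Lemma upd_same z i x : upd z i x i = x.
Proof. by rewrite /upd eqxx. Qed.

Lemma upd_other z i j x : j != i -> upd z i x j = z j.
Proof. by rewrite /upd => /negbTE ->. Qed.

Lemma upd_id z i : upd z i (z i) = z.
Proof.
by apply: functional_extensionality => j; rewrite /upd; case: eqP => // ->.
Qed.

Lemma upd_upd z i x y : upd (upd z i x) i y = upd z i y.
Proof. by apply: functional_extensionality => j; rewrite /upd; case: eqP. Qed.

Lemma updC z i j x y : i != j -> upd (upd z i x) j y = upd (upd z j y) i x.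
Proof.
move=> nij; apply: functional_extensionality => k; rewrite /upd.
by case: (eqVneq k j) => // ->; rewrite eq_sym (negbTE nij).
Qed.

Lemma ball_coordP z (e : R) y :
  ball z e y <-> forall i, Rabs (y i - z i) < e.
Proof. by []. Qed.

Lemma ball_upd z i x (e : posreal) : Rabs (x - z i) < e -> ball z e (upd z i x).
Proof.
move=> xe; apply/ball_coordP => j; rewrite /upd; case: eqP => [->|_] //.
by rewrite Rminus_diag Rabs_R0; apply: cond_pos.
Qed.

Lemma open_upd D z i :
  open D -> D z -> locally (z i) (fun x => D (upd z i x)).
Proof.
move=> oD /oD [e He]; exists e => x xe; apply: He.
exact: ball_upd.
Qed.

Lemma continuous_coordP (F : (I -> R) -> R) z :
  continuous F z <->
  forall eps : posreal, exists d : posreal, forall y,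
    (forall i, Rabs (y i - z i) < d) -> Rabs (F y - F z) < eps.
Proof.
split.
  move=> /filterlim_locally H eps; have [d Hd] := H eps.
  by exists d => y /ball_coordP /Hd.
move=> H; apply/filterlim_locally => eps; have [d Hd] := H eps.
by exists d => y /ball_coordP /Hd.
Qed.

Lemma pds_rcons (w : seq I) i F : pds (rcons w i) F = pds w (pd i F).
Proof. by rewrite /pds foldr_rcons. Qed.

Lemma pd_ext_loc D F G z i : open D -> (forall y, D y -> F y = G y) ->
  D z -> pd i F z = pd i G z.
Proof.
move=> oD FG Dz; apply: Derive_ext_loc.
by apply: filter_imp (open_upd i oD Dz) => x; apply: FG.
Qed.

Lemma smooth_on_pd D F i : smooth_on D F -> smooth_on D (pd i F).
Proof. by move=> sF w z /(sF (rcons w i)); rewrite pds_rcons. Qed.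

Lemma smooth_on_continuous D F z : smooth_on D F -> D z -> continuous F z.
Proof. by move=> sF /(sF [::]) []. Qed.

Lemma smooth_on_ex_derive D F z i : smooth_on D F -> D z ->
  ex_derive (fun x => F (upd z i x)) (z i).
Proof. by move=> sF /(sF [::]) []. Qed.

Lemma smooth_on_is_derive D F z i x : smooth_on D F -> D (upd z i x) ->
  is_derive (fun y => F (upd z i y)) x (pd i F (upd z i x)).
Proof.
move=> sF Dz; have := smooth_on_ex_derive i sF Dz.
rewrite /pd upd_same => /Derive_correct.
have E : (fun y => F (upd (upd z i x) i y)) = (fun y => F (upd z i y)).
  by apply: functional_extensionality => y; rewrite upd_upd.
by rewrite E.
Qed.

(** Iterated partial derivatives never leave a class closed under [pd], so first-order regularity of
    all its members suffices. *)
Lemma smooth_on_coind D (C : ((I -> R) -> R) -> Prop) :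
  (forall F, C F -> forall z, D z ->
     continuous F z /\ forall i, ex_derive (fun x => F (upd z i x)) (z i)) ->
  (forall F i, C F -> C (pd i F)) ->
  forall F, C F -> smooth_on D F.
Proof.
move=> C1 Cpd F CF w; have {}CF : C (pds w F) by elim: w => //= i w; apply: Cpd.
by move=> z; apply: C1.
Qed.

(** Only points of [D] are compared, since the values elsewhere carry no meaning. For [jet_dom] and
    [coords N] this is [order_le N]. *)
Definition supported D (s : seq I) (F : (I -> R) -> R) : Prop :=
  forall z y, D z -> D y -> {in s, z =1 y} -> F z = F y.

Lemma supported_pd D s F i : open D -> supported D s F -> supported D s (pd i F).
Proof.
move=> oD sF z y Dz Dy zy; rewrite /pd.
case: (boolP (i \in s)) => [si | nsi]; last first.
  have C u : D u -> Derive (fun x => F (upd u i x)) (u i) = 0.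
    move=> Du; rewrite (@Derive_ext_loc _ (fun _ => F u)) ?Derive_const //.
    apply: filter_imp (open_upd i oD Du) => x Dx; apply: sF => // j sj.
    by rewrite upd_other //; apply/eqP => ji; move: nsi; rewrite -ji sj.
  by rewrite !C.
rewrite zy //; apply: Derive_ext_loc.
have := open_upd i oD Dz; rewrite zy // => lz.
apply: filter_imp (filter_and _ _ lz (open_upd i oD Dy)) => x [Dzx Dyx].
by apply: sF => // j sj; rewrite /upd; case: eqP => // _; apply: zy.
Qed.

Lemma pd_unsupported D s F i z : open D -> supported D s F -> i \notin s ->
  D z -> pd i F z = 0.
Proof.
move=> oD sF nsi Dz; rewrite /pd (@Derive_ext_loc _ (fun _ => F z)) ?Derive_const //.
apply: filter_imp (open_upd i oD Dz) => x Dx; apply: sF => // j sj.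
by rewrite upd_other //; apply/eqP => ji; move: nsi; rewrite -ji sj.
Qed.

End Coordinates.

(** * The chain rule *)

(** Caratheodory's form of the chain rule: near [x0] the increment of [g] is that of [h] times a
    slope [q'] tending to [q]. The error is [q'] times the error of [h], plus
    [(q' - q) * h' * (x - x0)]; each part gets half of [eps], and the [+ 1] in the denominators
    guards against [q = 0] or [h' = 0]. *)
Lemma is_derive_increment (g h : R -> R) (x0 q h' : R) :
  (forall eps : posreal, locally x0 (fun x =>
     exists2 q', Rabs (q' - q) < eps & g x - g x0 = q' * (h x - h x0))) ->
  is_derive h x0 h' -> is_derive g x0 (q * h').
Proof.
move=> Hq [_ Hh]; split; first exact: is_linear_scal_l.
move=> x /is_filter_lim_locally_unique <- eps.
have Hx0 : is_filter_lim (locally x0) x0 by [].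
have e1p : 0 < eps / 2 / (Rabs q + 1).
  by apply: Rdiv_lt_0_compat; [have := cond_pos eps; lra | have := Rabs_pos q; lra].
have e2p : 0 < Rmin 1 (eps / 2 / (Rabs h' + 1)).
  apply: Rmin_glb_lt; first lra.
  by apply: Rdiv_lt_0_compat; [have := cond_pos eps; lra | have := Rabs_pos h'; lra].
have A := Hh x0 Hx0 (mkposreal _ e1p).
apply: filter_imp (filter_and _ _ A (Hq (mkposreal _ e2p))) => y [{}A [q' B E]].
move: A B; rewrite /norm /= /abs /= /minus /plus /opp /scal /= /mult /= => A B.
replace (g y + - g x0) with (q' * (h y - h x0)) by lra.
replace (q' * (h y - h x0) + - ((y + - x0) * (q * h'))) with
  (q' * (h y + - h x0 + - ((y + - x0) * h')) + (q' - q) * h' * (y + - x0)) by ring.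
apply: Rle_trans (Rabs_triang _ _) _; rewrite !Rabs_mult.
set u := Rabs (y + - x0) in A *; have u0 : 0 <= u := Rabs_pos _.
set v := Rabs (h y + _ + _) in A *; have v0 : 0 <= v := Rabs_pos _.
have B1 : Rabs (q' - q) < 1 := Rlt_le_trans _ _ _ B (Rmin_l _ _).
have B2 : Rabs (q' - q) < eps / 2 / (Rabs h' + 1) := Rlt_le_trans _ _ _ B (Rmin_r _ _).
have q'1 : Rabs q' <= Rabs q + 1.
  by replace q' with (q + (q' - q)) by ring; have := Rabs_triang q (q' - q); lra.
have T1 : Rabs q' * v <= eps / 2 * u.
  apply: Rle_trans (_ : (Rabs q + 1) * (eps / 2 / (Rabs q + 1) * u) <= _).
    by apply: Rmult_le_compat => //; apply: Rabs_pos.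
  by apply: Req_le; field; have := Rabs_pos q; lra.
have T2 : Rabs (q' - q) * Rabs h' <= eps / 2.
  apply: Rle_trans (_ : eps / 2 / (Rabs h' + 1) * (Rabs h' + 1) <= _).
    by apply: Rmult_le_compat; try apply: Rabs_pos; lra.
  by apply: Req_le; field; have := Rabs_pos h'; lra.
have T3 : Rabs (q' - q) * Rabs h' * u <= eps / 2 * u by apply: Rmult_le_compat_r.
have -> : eps * u = eps / 2 * u + eps / 2 * u by field.
exact: Rplus_le_compat.
Qed.

Lemma locally_coords (I : eqType) (s : seq I) (c : R -> I -> R) (x0 : R) (e : posreal) :
  (forall i, i \in s -> continuous (fun x => c x i) x0) ->
  locally x0 (fun x => {in s, forall i, Rabs (c x i - c x0 i) < e}).
Proof.
elim: s => [|i s IH] cs; first by apply: filter_forall.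
have Hi : locally x0 (fun x => Rabs (c x i - c x0 i) < e).
  by have /filterlim_locally /(_ e) := cs i (mem_head _ _).
have {}IH := IH (fun j sj => cs j (mem_behead (s := i :: s) sj)).
apply: filter_imp (filter_and _ _ Hi IH) => x [xi xs] j; rewrite in_cons.
by case/orP => [/eqP -> // | /xs].
Qed.

Section ChainRule.
Variables (I : eqType) (D : (I -> R) -> Prop) (f : (I -> R) -> R).
Hypotheses (oD : open D) (sf : smooth_on D f).

(** One coordinate is peeled off at a time. By the mean value theorem the change of [f] due to
    coordinate [k] has as slope [pd k f] at an intermediate point, and continuity of [pd k f] brings
    it close to the value at [c x0]. Constancy of the coordinates outside [s] makes the curve
    uniformly close to [c x0]. *)
Lemma chain_rule_aux (s : seq I) (c : R -> I -> R) (c' : I -> R) (x0 : R) :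
  uniq s -> D (c x0) -> (forall x i, i \notin s -> c x i = c x0 i) ->
  (forall i, i \in s -> is_derive (fun x => c x i) x0 (c' i)) ->
  is_derive (fun x => f (c x)) x0 (Rsum s (fun i => pd i f (c x0) * c' i)).
Proof.
elim: s c => [|k s IH] c.
  move=> _ _ cc _ /=; apply: (is_derive_ext (fun _ => f (c x0))).
    by move=> t; congr f; apply: functional_extensionality => i; rewrite cc.
  exact: is_derive_const.
move=> /andP [nks us] Dc cc dc.
(* The curve with coordinate [k] frozen at time [x0]: it moves only along [s], so the induction
   hypothesis covers it. *)
pose d x := upd (c x) k (c x0 k).
have d0 : d x0 = c x0 by rewrite /d upd_id.
have Hd : is_derive (fun x => f (d x)) x0 (Rsum s (fun i => pd i f (c x0) * c' i)).
  rewrite -d0; apply: IH; rewrite ?d0 //.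
    move=> x i nis; rewrite /d /upd; case: eqP => [-> //|/eqP nik].
    by rewrite cc // in_cons negb_or nik.
  move=> i si; have nik : i != k by apply/eqP => ik; move: nks; rewrite -ik si.
  apply: (is_derive_ext (fun x => c x i)) => [x|]; first by rewrite /d upd_other.
  by apply: dc; rewrite in_cons si orbT.
have Hg : is_derive (fun x => f (c x) - f (d x)) x0 (pd k f (c x0) * c' k).
  apply: (is_derive_increment (h := fun x => c x k)); last by apply: dc; apply: mem_head.
  move=> eps.
  have /continuous_coordP /(_ eps) [e1 H1] :=
    smooth_on_continuous (smooth_on_pd k sf) Dc.
  have [e2 H2] := oD Dc.
  have ep : 0 < Rmin e1 e2 by apply: Rmin_glb_lt; apply: cond_pos.
  have Lc := locally_coords (s := k :: s) (c := c) (x0 := x0) (mkposreal _ ep)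
    (fun i si => ex_derive_continuous _ _ (ex_intro _ _ (dc i si))).
  apply: filter_imp Lc => x /= xs.
  have near y : Rmin (c x0 k) (c x k) <= y <= Rmax (c x0 k) (c x k) ->
      forall i, Rabs (upd (c x) k y i - c x0 i) < Rmin e1 e2.
    move=> yb i; rewrite /upd; case: (eqVneq i k) => [-> | nik].
      apply: Rle_lt_trans (xs k (mem_head _ _)); move: yb.
      rewrite /Rmin /Rmax /Rabs; case: Rle_dec => ?; do 2!case: Rcase_abs => ?; lra.
    case: (boolP (i \in s)) => [si | nsi]; first by apply: xs; rewrite in_cons si orbT.
    by rewrite cc ?in_cons ?negb_or ?nik // Rminus_diag Rabs_R0.
  have inD y : Rmin (c x0 k) (c x k) <= y <= Rmax (c x0 k) (c x k) ->
      D (upd (c x) k y).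
    move=> /near ny; apply: H2 => i; apply: Rlt_le_trans (ny i) (Rmin_r _ _).
  have [|| xi [xib E]] := @MVT_gen (fun y => f (upd (c x) k y)) (c x0 k) (c x k)
    (fun y => pd k f (upd (c x) k y)).
  - by move=> y yb; apply: (smooth_on_is_derive sf); apply: inD; lra.
  - move=> y yb; apply/continuity_pt_filterlim; apply: ex_derive_continuous.
    by eexists; apply: (smooth_on_is_derive sf); apply: inD; lra.
  exists (pd k f (upd (c x) k xi)); last first.
    by rewrite d0 -E /d upd_id; ring.
  by apply: H1 => i; apply: Rlt_le_trans (near _ xib i) (Rmin_l _ _).
apply: (is_derive_ext (fun x => (f (c x) - f (d x)) + f (d x))) => [x /=|].
  by ring.
exact: (@is_derive_plus R_AbsRing R_NormedModule).
Qed.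

Lemma is_derive_comp_coords (s : seq I) (c : R -> I -> R) (c' : I -> R) (x0 : R) :
  uniq s -> supported D s f ->
  D (c x0) -> locally x0 (fun x => D (c x)) ->
  (forall i, i \in s -> is_derive (fun x => c x i) x0 (c' i)) ->
  is_derive (fun x => f (c x)) x0 (Rsum s (fun i => pd i f (c x0) * c' i)).
Proof.
move=> us sup Dc lD dc.
(* The coordinates outside [s] are frozen, so that the modified curve is continuous. *)
pose d x i := if i \in s then c x i else c x0 i.
have d0 : d x0 = c x0 by apply: functional_extensionality => i; rewrite /d; case: ifP.
have Hd : is_derive (fun x => f (d x)) x0 (Rsum s (fun i => pd i f (d x0) * c' i)).
  apply: chain_rule_aux => //; first by rewrite d0.
    by move=> x i nis; rewrite /d (negbTE nis).
  move=> i si; apply: (is_derive_ext (fun x => c x i)); last exact: dc.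
  by move=> x; rewrite /d si.
rewrite d0 in Hd; apply: is_derive_ext_loc Hd.
have [e He] := oD Dc.
have Lc := locally_coords (s := s) (c := c) (x0 := x0) e
    (fun i si => ex_derive_continuous _ _ (ex_intro _ _ (dc i si))).
apply: filter_imp (filter_and _ _ Lc lD) => x [xs Dx].
apply: sup => //; last by move=> i si; rewrite /d si.
apply: He => i; rewrite /d; case: ifP => [/xs //|_].
by rewrite /ball /= /AbsRing_ball /= /abs /= /minus /plus /opp /= Rplus_opp_r Rabs_R0;
  apply: cond_pos.
Qed.

End ChainRule.

(** * Closure properties of smooth functions *)

Section SmoothClosure.
Variables (I : eqType) (D : (I -> R) -> Prop).
Hypothesis oD : open D.

Section Class.
Variables (K : eqType) (E : (K -> R) -> Prop) (s : seq K).
Hypotheses (oE : open E) (us : uniq s).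

(* This class is closed under [pd], so that its members, being C1, are smooth. *)
Inductive smooth_expr : ((I -> R) -> R) -> Prop :=
| SE_base F : smooth_on D F -> smooth_expr F
| SE_const a : smooth_expr (fun _ => a)
| SE_coord i : smooth_expr (fun z => z i)
| SE_ext F G : smooth_expr F -> (forall z, D z -> F z = G z) -> smooth_expr G
| SE_plus F G : smooth_expr F -> smooth_expr G -> smooth_expr (fun z => F z + G z)
| SE_mult F G : smooth_expr F -> smooth_expr G -> smooth_expr (fun z => F z * G z)
| SE_inv F : (forall z, D z -> F z <> 0) -> smooth_expr F -> smooth_expr (fun z => / F z)
| SE_comp f (G : K -> (I -> R) -> R) : smooth_on E f -> supported E s f ->
    (forall k, smooth_expr (G k)) -> (forall z, D z -> E (fun k => G k z)) ->
    smooth_expr (fun z => f (fun k => G k z)).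

Lemma smooth_expr_Rsum (A : Type) (t : seq A) (F : A -> (I -> R) -> R) :
  (forall a, smooth_expr (F a)) -> smooth_expr (fun z => Rsum t (F^~ z)).
Proof.
move=> sF; elim: t => [|a t IH] /=; first exact: SE_const.
exact: (SE_plus (F := F a) (G := fun z => Rsum t (F^~ z))).
Qed.

Lemma is_derive_pd (F : (I -> R) -> R) z i : ex_derive (fun x => F (upd z i x)) (z i) ->
  is_derive (fun x => F (upd z i x)) (z i) (pd i F z).
Proof. exact: Derive_correct. Qed.

Lemma smooth_expr_C1 F : smooth_expr F -> forall z, D z ->
  continuous F z /\ forall i, ex_derive (fun x => F (upd z i x)) (z i).
Proof.
elim=> {F}.
- by move=> F /(_ [::]).
- move=> a z _; split; first exact: continuous_const.
  by move=> i; apply: ex_derive_const.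
- move=> i z _; split.
    by apply/continuous_coordP => eps; exists eps => y.
  move=> j; case: (eqVneq i j) => [<-|nij].
    apply: (ex_derive_ext id); last exact: ex_derive_id.
    by move=> x; rewrite upd_same.
  apply: (ex_derive_ext (fun _ => z i)); last exact: ex_derive_const.
  by move=> x; rewrite upd_other.
- move=> F G _ IH FG z Dz; have [cF dF] := IH z Dz; split.
    apply: (continuous_ext_loc G F _ _ cF).
    by apply: filter_imp (oD Dz) => y /FG.
  move=> i; apply: ex_derive_ext_loc (dF i).
  by apply: filter_imp (open_upd i oD Dz) => y /FG.
- move=> F G _ IHF _ IHG z Dz.
  have [cF dF] := IHF z Dz; have [cG dG] := IHG z Dz; split.
    exact: (@continuous_plus _ R_AbsRing R_NormedModule).
  by move=> i; apply: (@ex_derive_plus R_AbsRing R_NormedModule).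
- move=> F G _ IHF _ IHG z Dz.
  have [cF dF] := IHF z Dz; have [cG dG] := IHG z Dz; split.
    exact: (@continuous_mult _ R_AbsRing).
  by move=> i; apply: ex_derive_mult.
- move=> F F0 _ IH z Dz; have [cF dF] := IH z Dz; split.
    by apply: (continuous_comp F Rinv) => //; apply: continuous_Rinv; apply: F0.
  by move=> i; apply: ex_derive_inv => //; rewrite upd_id; apply: F0.
- move=> f G sf sup _ IH GE z Dz; split.
    apply/continuous_coordP => eps.
    have /continuous_coordP /(_ eps) [e1 H1] := smooth_on_continuous sf (GE z Dz).
    have [e2 H2] := oE (GE z Dz).
    have ep : 0 < Rmin e1 e2 by apply: Rmin_glb_lt; apply: cond_pos.
    have Ls : locally z (fun y => {in s, forall k, Rabs (G k y - G k z) < Rmin e1 e2}).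
      elim: s => [|k t IHt]; first exact: filter_forall.
      have [/filterlim_locally /(_ (mkposreal _ ep)) Hk _] := IH k z Dz.
      apply: filter_imp (filter_and _ _ Hk IHt) => y [yk ys] j; rewrite in_cons.
      by case/orP => [/eqP -> // | /ys].
    have [d Hd] := filter_and _ _ Ls (oD Dz).
    exists d => y /ball_coordP /Hd [ys Dy].
    (* Closeness of [G k y] to [G k z] is uniform only over the finite list [s]. Resetting the other
       coordinates does not change [f], by its support. *)
    pose u k := if k \in s then G k y else G k z.
    have near k : Rabs (u k - G k z) < Rmin e1 e2.
      by rewrite /u; case: ifP => [/ys //|_]; rewrite Rminus_diag Rabs_R0.
    rewrite -(sup u); first by apply: H1 => k; apply: Rlt_le_trans (near k) (Rmin_l _ _).
    + by apply: H2 => k; apply: Rlt_le_trans (near k) (Rmin_r _ _).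
    + exact: GE.
    + by move=> k sk; rewrite /u sk.
  move=> i; eexists; apply: (is_derive_comp_coords oE sf us sup
      (c := fun x k => G k (upd z i x)) (c' := fun k => pd i (G k) z)) => /=.
  + by rewrite upd_id; apply: GE.
  + by apply: filter_imp (open_upd i oD Dz) => x /GE.
  + by move=> k _; apply: is_derive_pd; apply: (IH k z Dz).2.
Qed.

Lemma smooth_expr_ex F z i : smooth_expr F -> D z ->
  ex_derive (fun x => F (upd z i x)) (z i).
Proof. by move=> /smooth_expr_C1 H /H []. Qed.

Lemma smooth_expr_pd F i : smooth_expr F -> smooth_expr (pd i F).
Proof.
elim=> {F}.
- by move=> F sF; apply: SE_base; apply: smooth_on_pd.
- move=> a; apply: SE_ext (SE_const 0) _ => z _.
  by rewrite /pd Derive_const.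
- move=> j; apply: SE_ext (SE_const (if j == i then 1 else 0)) _ => z _.
  by rewrite /pd /upd; case: eqP => _; rewrite ?Derive_const ?Derive_id.
- move=> F G _ IH FG; apply: SE_ext IH _ => z Dz.
  exact: pd_ext_loc oD FG Dz.
- move=> F G eF IHF eG IHG; apply: SE_ext (SE_plus IHF IHG) _ => z Dz.
  by rewrite {3}/pd Derive_plus //; apply: smooth_expr_ex.
- move=> F G eF IHF eG IHG.
  apply: SE_ext (SE_plus (SE_mult IHF eG) (SE_mult eF IHG)) _ => z Dz.
  by rewrite {3}/pd Derive_mult ?upd_id //; apply: smooth_expr_ex.
- move=> F F0 eF IHF.
  apply: SE_ext (SE_mult (SE_mult (SE_const (-1)) IHF)
                  (SE_mult (SE_inv F0 eF) (SE_inv F0 eF))) _ => z Dz.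
  rewrite {2}/pd Derive_inv ?upd_id //; try exact: F0; last exact: smooth_expr_ex.
  by rewrite -/(pd i F z); field; apply: F0.
- move=> f G sf sup eG IH GE.
  apply: SE_ext (smooth_expr_Rsum s (F := fun k z => pd k f (fun j => G j z) * pd i (G k) z) _) _.
    move=> k; apply: (SE_mult (F := fun z => pd k f (fun j => G j z))) => //.
    by apply: SE_comp => //; [apply: smooth_on_pd | apply: supported_pd].
  move=> z Dz; apply/esym/is_derive_unique.
  have -> : Rsum s (fun k => pd k f (G^~ z) * pd i (G k) z)
          = Rsum s (fun k => pd k f (fun j => G j (upd z i (z i))) * pd i (G k) z).
    by rewrite upd_id.
  apply: (is_derive_comp_coords oE sf us sup
      (c := fun x k => G k (upd z i x)) (c' := fun k => pd i (G k) z)) => /=.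
  + by rewrite upd_id; apply: GE.
  + by apply: filter_imp (open_upd i oD Dz) => x /GE.
  + by move=> k _; apply: is_derive_pd; apply: smooth_expr_ex.
Qed.

Lemma smooth_expr_smooth F : smooth_expr F -> smooth_on D F.
Proof.
by apply: smooth_on_coind => [G /smooth_expr_C1 //| G i]; apply: smooth_expr_pd.
Qed.

Lemma smooth_on_comp f (G : K -> (I -> R) -> R) :
  smooth_on E f -> supported E s f -> (forall k, smooth_on D (G k)) ->
  (forall z, D z -> E (fun k => G k z)) ->
  smooth_on D (fun z => f (fun k => G k z)).
Proof.
move=> sf sup sG GE; apply: smooth_expr_smooth.
by apply: SE_comp => // k; apply: SE_base.
Qed.

Lemma pd_comp f (G : K -> (I -> R) -> R) z i :
  smooth_on E f -> supported E s f -> (forall k, smooth_on D (G k)) ->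
  (forall z, D z -> E (fun k => G k z)) -> D z ->
  pd i (fun z => f (fun k => G k z)) z
  = Rsum s (fun k => pd k f (fun j => G j z) * pd i (G k) z).
Proof.
move=> sf sup sG GE Dz; apply/is_derive_unique.
have -> : Rsum s (fun k => pd k f (G^~ z) * pd i (G k) z)
        = Rsum s (fun k => pd k f (fun j => G j (upd z i (z i))) * pd i (G k) z).
  by rewrite upd_id.
apply: (is_derive_comp_coords oE sf us sup
    (c := fun x k => G k (upd z i x)) (c' := fun k => pd i (G k) z)) => /=.
+ by rewrite upd_id; apply: GE.
+ by apply: filter_imp (open_upd i oD Dz) => x /GE.
+ by move=> k _; apply: is_derive_pd; apply: smooth_on_ex_derive (sG k) Dz.
Qed.

End Class.

(** The composition data are dummies: the rules below use only the arithmetic constructors of the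
    class. *)
Let expr_smooth F := smooth_expr_smooth (K := I) (E := D) (s := [::]) oD isT (F := F).

Lemma smooth_on_ext F G : smooth_on D F -> (forall z, D z -> F z = G z) -> smooth_on D G.
Proof. by move=> sF FG; apply: expr_smooth; apply: SE_ext FG; apply: SE_base. Qed.

Lemma smooth_on_const a : smooth_on D (fun _ => a).
Proof. by apply: expr_smooth; apply: SE_const. Qed.

Lemma smooth_on_coord i : smooth_on D (fun z => z i).
Proof. by apply: expr_smooth; apply: SE_coord. Qed.

Lemma smooth_on_plus F G : smooth_on D F -> smooth_on D G ->
  smooth_on D (fun z => F z + G z).
Proof. by move=> sF sG; apply: expr_smooth; apply: SE_plus; apply: SE_base. Qed.

Lemma smooth_on_mult F G : smooth_on D F -> smooth_on D G ->
  smooth_on D (fun z => F z * G z).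
Proof. by move=> sF sG; apply: expr_smooth; apply: SE_mult; apply: SE_base. Qed.

Lemma smooth_on_inv F : (forall z, D z -> F z <> 0) -> smooth_on D F ->
  smooth_on D (fun z => / F z).
Proof. by move=> F0 sF; apply: expr_smooth; apply: SE_inv => //; apply: SE_base. Qed.

Lemma smooth_on_Rsum (A : Type) (t : seq A) (F : A -> (I -> R) -> R) :
  (forall a, smooth_on D (F a)) -> smooth_on D (fun z => Rsum t (F^~ z)).
Proof.
by move=> sF; apply: expr_smooth; apply: smooth_expr_Rsum => a; apply: SE_base.
Qed.

Lemma smooth_on_pow F m : smooth_on D F -> smooth_on D (fun z => F z ^ m).
Proof.
move=> sF; elim: m => [|m IH] /=; first exact: smooth_on_const.
exact: smooth_on_mult.
Qed.

Lemma pd_plus F G z i : smooth_on D F -> smooth_on D G -> D z ->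
  pd i (fun y => F y + G y) z = pd i F z + pd i G z.
Proof. by move=> sF sG Dz; rewrite /pd Derive_plus //; apply: smooth_on_ex_derive Dz. Qed.

Lemma pd_mult F G z i : smooth_on D F -> smooth_on D G -> D z ->
  pd i (fun y => F y * G y) z = pd i F z * G z + F z * pd i G z.
Proof.
by move=> sF sG Dz; rewrite /pd Derive_mult ?upd_id //; apply: smooth_on_ex_derive Dz.
Qed.

End SmoothClosure.

(** * The total derivative *)

Fixpoint coords (N : nat) : seq coord :=
  if N is N'.+1 then [:: Jet Vel N, Jet Dens N, Jet Entr N & coords N']
  else [:: Time; Radius; Jet Vel 0; Jet Dens 0; Jet Entr 0].

Lemma mem_coords N c : (c \in coords N) = (coord_order c <= N)%N.
Proof.
elim: N c => [|N IH] [||v k] //=; first by case: v k => [] [|k].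
all: rewrite !in_cons IH /= ?orbT //.
rewrite [in RHS]leq_eqVlt ltnS !orbA; congr (_ || _).
case: (eqVneq k N.+1) => [->|/eqP nk]; first by case: v; rewrite eqxx ?orbT.
by apply/negbTE; rewrite !negb_or -!andbA; apply/and3P; split; apply/eqP => -[].
Qed.

Lemma uniq_coords N : uniq (coords N).
Proof.
elim: N => //= N ->.
by rewrite !in_cons !mem_coords /= ltnn.
Qed.

Lemma order_leP N F : order_le N F <-> supported jet_dom (coords N) F.
Proof.
split=> H z y Dz Dy zy; apply: H => // c.
  by rewrite -mem_coords => /zy.
by rewrite mem_coords => /zy.
Qed.

Lemma order_leW N M F : (N <= M)%N -> order_le N F -> order_le M F.
Proof.
by move=> NM H z y Dz Dy zy; apply: H => // c cN; apply: zy; apply: leq_trans NM.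
Qed.

Lemma open_jet_dom : open jet_dom.
Proof.
move=> z [z1 z2]; have ep : 0 < Rmin (z Radius) (z (Jet Dens 0)) by apply: Rmin_glb_lt.
exists (mkposreal _ ep) => y /ball_coordP /= H; split.
  have := Rlt_le_trans _ _ _ (H Radius) (Rmin_l _ _).
  by rewrite /Rabs; case: Rcase_abs => ?; lra.
have := Rlt_le_trans _ _ _ (H (Jet Dens 0)) (Rmin_r _ _).
by rewrite /Rabs; case: Rcase_abs => ?; lra.
Qed.

Lemma order_le_pd N F c : order_le N F -> order_le N (pd c F).
Proof. by move=> /order_leP H; apply/order_leP; apply: supported_pd open_jet_dom H. Qed.

Lemma pd_order_gt N F c z : order_le N F -> (N < coord_order c)%N -> jet_dom z ->
  pd c F z = 0.
Proof.
move=> /order_leP H Nc; apply: pd_unsupported open_jet_dom H _.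
by rewrite mem_coords -ltnNge.
Qed.

(** The coefficients of D_r as a vector field on jet space; [Time] gets 0 because the derivative is
    taken at fixed t. *)
Definition shift (z : jet_point) (c : coord) : R :=
  match c with Time => 0 | Radius => 1 | Jet v k => z (Jet v k.+1) end.

(** The terms of the series beyond index [N] vanish, so the partial sums are eventually constant.
    The finite form is the one to which the chain rule applies. *)
Lemma Dr_Rsum N F z : order_le N F -> jet_dom z ->
  Dr F z = Rsum (coords N) (fun c => pd c F z * shift z c).
Proof.
move=> oF Dz; set b := fun c => _.
pose a k := b (Jet Vel k) + b (Jet Dens k) + b (Jet Entr k).
have -> : Rsum (coords N) b = pd Radius F z + sum_n a N.
  have -> : pd Radius F z = b Time + b Radius by rewrite /b /=; ring.
  elim: {oF} N => [|N /= ->]; first by rewrite sum_O /= /a; ring.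
  by rewrite sum_Sn /plus /= [a N.+1]/a; ring.
congr (_ + _); apply: is_series_unique.
apply: (filterlim_ext_loc (fun _ => sum_n a N)); last exact: filterlim_const.
exists N => m /leP Nm; rewrite -(subnK Nm).
have E k : a k = z (Jet Vel k.+1) * pd (Jet Vel k) F z
                 + z (Jet Dens k.+1) * pd (Jet Dens k) F z
                 + z (Jet Entr k.+1) * pd (Jet Entr k) F z.
  by rewrite /a /b /=; ring.
rewrite (sum_n_ext _ a) => [|k]; last by rewrite E.
elim: (m - N)%N => [|k IH] //; rewrite addSn sum_Sn -IH.
have -> : a (k + N).+1 = zero.
  by rewrite /a /b !(pd_order_gt oF) /= ?ltnS ?leq_addl // /zero /=; ring.
by rewrite plus_zero_r.
Qed.

Lemma Dr_ext F G z : (forall y, jet_dom y -> F y = G y) -> jet_dom z ->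
  Dr F z = Dr G z.
Proof.
move=> FG Dz; have E c := pd_ext_loc c open_jet_dom FG Dz.
by rewrite /Dr E; congr (_ + _); apply: Series_ext => k; rewrite !E.
Qed.

Lemma order_le_Dr N F : order_le N F -> order_le N.+1 (Dr F).
Proof.
move=> oF z y Dz Dy zy; rewrite !(Dr_Rsum oF) //.
apply: eq_Rsum => c; rewrite mem_coords => cN; congr (_ * _).
  by apply: (order_le_pd c oF) => // c' c'N; apply: zy; apply: leqW.
by case: c cN => //= v k kN; apply: zy.
Qed.

Lemma smooth_on_shift c : smooth_on jet_dom (fun z => shift z c).
Proof.
by case: c => [||v k]; rewrite /shift;
  [apply: (smooth_on_const open_jet_dom) ..| apply: (smooth_on_coord open_jet_dom)].
Qed.

Lemma smooth_on_Dr F : differential_function F -> smooth_on jet_dom (Dr F).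
Proof.
move=> [sF [N oF]].
apply: (smooth_on_ext open_jet_dom
  (F := fun z => Rsum (coords N) (fun c => pd c F z * shift z c))).
  apply: (smooth_on_Rsum open_jet_dom (coords N) (F := fun c z => pd c F z * shift z c)) => c.
  by apply: (smooth_on_mult open_jet_dom); [apply: smooth_on_pd | apply: smooth_on_shift].
by move=> z Dz; rewrite (Dr_Rsum oF).
Qed.

(** The coordinate [Jet v N.+1] enters [Dr F] only as the shift of [Jet v N]: the partial
    derivatives of [F] have order at most [N] and do not see it. Hence [Dr F] is affine in it. *)
Lemma Dr_upd_top N F v z x : order_le N F -> jet_dom z ->
  Dr F (upd z (Jet v N.+1) x)
  = Dr F z + pd (Jet v N) F z * (x - z (Jet v N.+1)).
Proof.
move=> oF Dz; have Dz' : jet_dom (upd z (Jet v N.+1) x).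
  by case: Dz => z1 z2; split; rewrite upd_other //; apply/eqP => -[].
rewrite !(Dr_Rsum oF) //; set b := fun c => _; set b' := fun c => _.
suff : Rsum (coords N) (fun c => b c - b' c) = b (Jet v N) - b' (Jet v N).
  rewrite Rsum_minus /b /b' /= upd_same.
  have -> : pd (Jet v N) F (upd z (Jet v N.+1) x) = pd (Jet v N) F z.
    apply: (order_le_pd (Jet v N) oF) => // c cN; rewrite upd_other //.
    by apply/eqP => cE; move: cN; rewrite cE /= ltnn.
  lra.
have E c : c \in coords N -> c != Jet v N -> b c - b' c = 0.
  rewrite mem_coords => cN cvN; rewrite /b /b'.
  have -> : pd c F (upd z (Jet v N.+1) x) = pd c F z.
    apply: (order_le_pd c oF) => // c' c'N; rewrite upd_other //.
    by apply/eqP => cE; move: c'N; rewrite cE /= ltnn.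
  suff -> : shift (upd z (Jet v N.+1) x) c = shift z c by ring.
  case: c cN cvN => //= w k kN wk; rewrite upd_other //.
  by apply: contra wk => /eqP [-> ->].
apply: (@Rsum_single _ _ (fun c => b c - b' c)) => //; first exact: uniq_coords.
by rewrite mem_coords /=.
Qed.

Lemma supported_enum (K : finType) (E : (K -> R) -> Prop) f : supported E (enum K) f.
Proof.
move=> z y _ _ zy; congr f; apply: functional_extensionality => k.
by apply: zy; rewrite mem_enum.
Qed.

Lemma Dr_comp (K : finType) (f : (K -> R) -> R) (G : K -> jet_point -> R) N z :
  smooth_on (fun _ => True) f -> (forall k, smooth_on jet_dom (G k)) ->
  (forall k, order_le N (G k)) -> jet_dom z ->
  Dr (fun y => f (fun k => G k y)) z
  = Rsum (enum K) (fun k => pd k f (fun j => G j z) * Dr (G k) z).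
Proof.
move=> sf sG oG Dz.
have oF : order_le N (fun y => f (fun k => G k y)).
  move=> y y' Dy Dy' yy'; congr f; apply: functional_extensionality => k.
  exact: oG.
rewrite (Dr_Rsum oF) //.
transitivity (Rsum (coords N) (fun c => Rsum (enum K)
    (fun k => pd k f (G^~ z) * (pd c (G k) z * shift z c)))).
  apply: eq_Rsum => c _.
  rewrite (pd_comp open_jet_dom open_true (enum_uniq K) c sf (@supported_enum _ _ _)) //.
  by rewrite -Rsum_mulr; apply: eq_Rsum => k _; ring.
rewrite exchange_Rsum; apply: eq_Rsum => k _.
rewrite (Dr_Rsum (oG k)) // Rmult_comm -Rsum_mulr.
by apply: eq_Rsum => c _; ring.
Qed.

Lemma smooth_on_comp_fin (I : eqType) (D : (I -> R) -> Prop) (K : finType)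
    (f : (K -> R) -> R) (G : K -> (I -> R) -> R) :
  open D -> smooth_on (fun _ => True) f -> (forall k, smooth_on D (G k)) ->
  smooth_on D (fun z => f (fun k => G k z)).
Proof.
move=> oD sf sG.
exact: (smooth_on_comp oD open_true (enum_uniq K) sf (@supported_enum _ _ _)).
Qed.

(** * The functions [J n l] *)

(** The reciprocal of the mass density r^(n-1) rho; [inv_mass n z * Dr] is differentiation in the
    Lagrangian mass coordinate. *)
Definition inv_mass (n : nat) (z : jet_point) : R :=
  / z Radius ^ (n - 1) / z (Jet Dens 0).

Lemma inv_mass_gt0 n z : jet_dom z -> 0 < inv_mass n z.
Proof.
move=> [z1 z2]; apply: Rdiv_lt_0_compat => //.
by apply: Rinv_0_lt_compat; apply: pow_lt.
Qed.

Lemma smooth_on_inv_mass n : smooth_on jet_dom (inv_mass n).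
Proof.
have c1 := smooth_on_coord open_jet_dom Radius.
have c2 := smooth_on_coord open_jet_dom (Jet Dens 0).
apply: (smooth_on_mult open_jet_dom); apply: (smooth_on_inv open_jet_dom) => //.
- by move=> z [z1 z2]; apply: pow_nonzero; lra.
- exact: (smooth_on_pow open_jet_dom).
- by move=> z [z1 z2]; lra.
Qed.

Lemma J_differential n l : smooth_on jet_dom (J n l) /\ order_le l (J n l).
Proof.
elim: l => [|l [sJ oJ]].
  split; first exact: (smooth_on_coord open_jet_dom (Jet Entr 0)).
  by move=> z y _ _ zy; apply: zy.
split.
  apply: (smooth_on_mult open_jet_dom (F := inv_mass n)); first exact: smooth_on_inv_mass.
  by apply: smooth_on_Dr; split; last exists l.
move=> z y Dz Dy zy /=; rewrite (order_le_Dr oJ Dz Dy zy).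
by rewrite (zy Radius) // (zy (Jet Dens 0)).
Qed.

Definition J_smooth n l := (J_differential n l).1.
Definition J_order n l := (J_differential n l).2.
Arguments J_smooth n l : clear implicits.
Arguments J_order n l : clear implicits.

Lemma JS n l z : J n l.+1 z = inv_mass n z * Dr (J n l) z.
Proof. by []. Qed.

Lemma Dr_J n l z : jet_dom z -> Dr (J n l) z = / inv_mass n z * J n l.+1 z.
Proof.
move=> Dz; have ? := inv_mass_gt0 n Dz.
by rewrite JS -Rmult_assoc Rinv_l ?Rmult_1_l; lra.
Qed.

Lemma jet_dom_upd_entr z k x : jet_dom z -> jet_dom (upd z (Jet Entr k) x).
Proof. by move=> [z1 z2]; split; rewrite upd_other. Qed.

(** Each application of the operator turns the slope in the top entropy jet into the slope in the
    next one, times [inv_mass], which itself involves no entropy. *)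
Lemma J_upd_entr n l z x : jet_dom z ->
  J n l (upd z (Jet Entr l) x) = J n l z + inv_mass n z ^ l * (x - z (Jet Entr l)).
Proof.
elim: l z x => [|l IH] z x Dz; first by rewrite /= upd_same; ring.
rewrite /= (Dr_upd_top _ _ (J_order n l) Dz) !upd_other //.
have -> : pd (Jet Entr l) (J n l) z = inv_mass n z ^ l.
  rewrite /pd (Derive_ext _ (fun y => J n l z + inv_mass n z ^ l * (y - z (Jet Entr l)))).
    apply: is_derive_unique; auto_derive => //; ring.
  by move=> y; apply: IH.
rewrite /inv_mass; ring.
Qed.

Lemma J_upd_entr_lt n i l z x : jet_dom z -> (i < l)%N ->
  J n i (upd z (Jet Entr l) x) = J n i z.
Proof.
move=> Dz il; apply: (J_order n i _ _ (jet_dom_upd_entr _ _ Dz) Dz).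
move=> c ci; rewrite upd_other //; apply/eqP => cE.
by move: ci; rewrite cE /= leqNgt il.
Qed.

(** Solves a triangular system: the entropy jet of order [k] is adjusted to give [J n k] its value,
    which leaves all earlier [J n i] unchanged. *)
Lemma J_surjective n l (x : nat -> R) :
  exists2 z, jet_dom z & forall i, (i <= l)%N -> J n i z = x i.
Proof.
have step k z : jet_dom z ->
    exists y, J n k (upd z (Jet Entr k) y) = x k.
  move=> Dz; exists (z (Jet Entr k) + (x k - J n k z) / inv_mass n z ^ k).
  rewrite J_upd_entr //; have := inv_mass_gt0 n Dz => ?.
  by field; apply: pow_nonzero; lra.
elim: l => [|l [z Dz Hz]].
  have D1 : jet_dom (fun _ => 1) by split; lra.
  have [y Hy] := step 0%N _ D1.
  exists (upd (fun _ => 1) (Jet Entr 0) y); first exact: jet_dom_upd_entr D1.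
  by move=> i; rewrite leqn0 => /eqP ->; exact: Hy.
have [y Hy] := step l.+1 _ Dz.
exists (upd z (Jet Entr l.+1) y); first exact: jet_dom_upd_entr Dz.
move=> i; rewrite leq_eqVlt => /orP [/eqP -> //|il].
by rewrite J_upd_entr_lt // Hz.
Qed.

(** * The density as a differential function *)

Section Density.
Variables (n l : nat) (f : ('I_l.+1 -> R) -> R).
Hypothesis sf : smooth_on (fun _ => True) f.

Lemma smooth_on_I_density : smooth_on jet_dom (I_density n f).
Proof.
apply: (smooth_on_mult open_jet_dom); first exact: (smooth_on_coord open_jet_dom).
by apply: (smooth_on_comp_fin (G := fun i : 'I_l.+1 => J n i) open_jet_dom sf) => i;
  apply: J_smooth.
Qed.

Lemma J_ord_order (i : 'I_l.+1) : order_le l (J n i).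
Proof. by apply: order_leW (J_order n i); rewrite -ltnS. Qed.

Lemma order_le_I_density : order_le l (I_density n f).
Proof.
move=> z y Dz Dy zy; rewrite /I_density (zy (Jet Dens 0)) //; congr (_ * f _).
apply: functional_extensionality => i; exact: J_ord_order.
Qed.

Lemma differential_I_density : differential_function (I_density n f).
Proof. by split; [exact: smooth_on_I_density | exists l; exact: order_le_I_density]. Qed.

Lemma J_upd_ord z x : jet_dom z ->
  (fun i : 'I_l.+1 => J n i (upd z (Jet Entr l) x))
  = upd (fun i : 'I_l.+1 => J n i z) ord_max
      (J n l z + inv_mass n z ^ l * (x - z (Jet Entr l))).
Proof.
move=> Dz; apply: functional_extensionality => i.
case: (eqVneq i ord_max) => [-> | il]; first by rewrite upd_same J_upd_entr.
rewrite upd_other // J_upd_entr_lt //.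
by have := ltn_ord i; rewrite ltnS leq_eqVlt => /orP [/eqP E|//]; case/eqP: il; apply: val_inj.
Qed.

Lemma has_order_I_density : (exists x y, f (upd x ord_max y) <> f x) ->
  has_order l (I_density n f).
Proof.
move=> [x [y fxy]]; split; first exact: order_le_I_density.
move=> j oj; rewrite leqNgt; apply/negP => jl; apply: fxy.
have [z Dz Jz] := J_surjective n l (fun i => x (inord i)).
have {}Jz : (fun i : 'I_l.+1 => J n i z) = x.
  by apply: functional_extensionality => i; rewrite Jz ?inord_val // -ltnS.
(* The value of the top entropy jet at which [J n l] equals [y]. *)
pose s := z (Jet Entr l) + (y - J n l z) / inv_mass n z ^ l.
have /= := oj (upd z (Jet Entr l) s) z (jet_dom_upd_entr _ _ Dz) Dz.
rewrite /I_density J_upd_ord // Jz upd_other //.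
have -> : J n l z + inv_mass n z ^ l * (s - z (Jet Entr l)) = y.
  by rewrite /s; field; apply: pow_nonzero; have := inv_mass_gt0 n Dz; lra.
move=> H; apply: (Rmult_eq_reg_l (z (Jet Dens 0))); last by case: Dz; lra.
apply: H => c cj; rewrite upd_other //; apply/eqP => cE.
by move: cj; rewrite cE /= leqNgt jl.
Qed.

End Density.

(** * Nonlinear densities are non-trivial *)

Lemma derive0_constant (g : R -> R) (a b : R) :
  (forall x, is_derive g x 0) -> g a = g b.
Proof.
move=> dg; have [|| x [_ E]] := @MVT_gen g b a (fun _ => 0).
- by move=> x _; apply: dg.
- move=> x _; apply/continuity_pt_filterlim; apply: ex_derive_continuous.
  by eexists; apply: dg.
- lra.
Qed.

Lemma pd_eq0_constant (I : eqType) (D : (I -> R) -> Prop) F z i x :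
  smooth_on D F -> (forall y, D (upd z i y)) ->
  (forall y, pd i F (upd z i y) = 0) -> F (upd z i x) = F z.
Proof.
move=> sF Dz dF; rewrite -[in RHS](upd_id z i).
apply: (@derive0_constant (fun y => F (upd z i y))) => y.
by rewrite -(dF y); apply: smooth_on_is_derive sF _.
Qed.

(** If [Theta] depended on a jet of order [k.+1], then [Dr Theta] would contain the matching jet of
    order [k.+2]. So these partial derivatives vanish, and since the points of [jet_dom] over fixed
    remaining coordinates form full lines, [Theta] is constant along them. *)
Lemma order_drop k Theta : smooth_on jet_dom Theta -> order_le k.+1 Theta ->
  order_le k.+1 (Dr Theta) -> order_le k Theta.
Proof.
move=> sT oT oD.
have D' z v x : jet_dom z -> jet_dom (upd z (Jet v k.+1) x).
  by case=> z1 z2; split; rewrite upd_other //; apply/eqP => -[].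
have pd0 z v : jet_dom z -> pd (Jet v k.+1) Theta z = 0.
  (* A unit change of the jet of order [k.+2] changes [Dr Theta] by exactly the partial derivative
     in question. *)
  move=> Dz; pose x := z (Jet v k.+2) + 1.
  have Dx : jet_dom (upd z (Jet v k.+2) x).
    by case: Dz => z1 z2; split; rewrite upd_other //; apply/eqP => -[].
  have := Dr_upd_top v x oT Dz; rewrite (oD _ z) //; first by rewrite /x; lra.
  move=> c ck; rewrite upd_other //; apply/eqP => cE.
  by move: ck; rewrite cE /= ltnn.
have step z v x : jet_dom z -> Theta (upd z (Jet v k.+1) x) = Theta z.
  by move=> Dz; apply: (pd_eq0_constant _ sT) => y; [|apply: pd0]; apply: D'.
move=> z y Dz Dy zy.
(* The three jets of order [k.+1] are moved from [z] to [y] one by one, after which the points agree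
   through order [k.+1]. *)
pose z1 := upd z (Jet Vel k.+1) (y (Jet Vel k.+1)).
pose z2 := upd z1 (Jet Dens k.+1) (y (Jet Dens k.+1)).
rewrite -(step z Vel (y (Jet Vel k.+1))) // -/z1.
rewrite -(step z1 Dens (y (Jet Dens k.+1))); last exact: D'.
rewrite -/z2 -(step z2 Entr (y (Jet Entr k.+1))); last exact/D'/D'.
apply: oT => //.
move=> c; rewrite leq_eqVlt => /orP [/eqP|ck].
  case: c => // v j /= ->; case: v; last by rewrite upd_same.
    by rewrite upd_other // /z2 upd_other // /z1 upd_same.
  by rewrite upd_other // /z2 upd_same.
have nc v : c != Jet v k.+1 by apply/eqP => cE; move: ck; rewrite cE /= ltnn.
by rewrite /z2 /z1 !upd_other ?nc //; apply: zy.
Qed.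

(** The descent stops at [m]: a function of order [m] has a total derivative of order at most
    [m.+1], so nothing more can be inferred. *)
Lemma order_drop_iter m d Theta : smooth_on jet_dom Theta -> order_le (d + m) Theta ->
  order_le m.+1 (Dr Theta) -> order_le m Theta.
Proof.
move=> sT; elim: d => [//|d IH]; rewrite addSn => oT oD; apply: (IH _ oD).
by apply: order_drop => //; apply: order_leW oD; rewrite ltnS leq_addl.
Qed.

Lemma pd_pd_affine (I : eqType) (f : (I -> R) -> R) i z (a b : R) :
  (forall y, f (upd z i y) = a + b * y) -> pd i (pd i f) z = 0.
Proof.
move=> fE; rewrite {1}/pd (Derive_ext _ (fun _ => b)) ?Derive_const // => x.
rewrite /pd upd_same (Derive_ext _ (fun y => a + b * y)) => [|y]; last by rewrite upd_upd.
by apply: is_derive_unique; auto_derive => //; ring.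
Qed.

Lemma smooth_on_radius_pow n : smooth_on jet_dom (fun z => z Radius ^ (n - 1)).
Proof. apply: (smooth_on_pow open_jet_dom); exact: (smooth_on_coord open_jet_dom). Qed.

Lemma nontrivial_I_density n l (f : ('I_l.+2 -> R) -> R) :
  smooth_on (fun _ => True) f ->
  (exists x, pd ord_max (pd ord_max f) x <> 0) ->
  nontrivial_at_order n l.+1 (I_density n f).
Proof.
move=> sf [x fx] [Phi0 [Psi [[Theta [sT [N oT]] Phi0E] [_ [k kl oPsi]] IE]]]; apply: fx.
pose T y := y Radius ^ (n - 1) * Theta y.
have sT' : smooth_on jet_dom T.
  by apply: (smooth_on_mult open_jet_dom); first exact: smooth_on_radius_pow.
have oT' : order_le N T.
  by move=> y y' Dy Dy' yy'; rewrite /T (oT _ y') // (yy' Radius).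
have DrT z : jet_dom z ->
    Dr T z = z Radius ^ (n - 1) * (I_density n f z - Psi z).
  by move=> Dz; rewrite -Phi0E // IE //; ring.
have oDrT : order_le l.+1 (Dr T).
  move=> z y Dz Dy zy; rewrite !DrT // (zy Radius) //.
  rewrite (order_le_I_density _ _ Dz Dy) // (oPsi z y) // => c ck; apply: zy.
  by apply: leq_trans ck _; apply: ltnW.
have {}oT' : order_le l T.
  by apply: (order_drop_iter (d := N) sT' _ oDrT); apply: order_leW oT'; apply: leq_addr.
have [z Dz Jz] := J_surjective n l.+1 (fun i => x (inord i)).
have {}Jz : (fun i : 'I_l.+2 => J n i z) = x.
  by apply: functional_extensionality => i; rewrite Jz ?inord_val // -ltnS.
have [z1 z2] := Dz; have w0 := inv_mass_gt0 n Dz.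
have w1 := pow_lt _ l.+1 w0; have r1 := pow_lt _ (n - 1) z1.
set w := inv_mass n z ^ l.+1 in w1 *; set r := z Radius ^ (n - 1) in r1 *.
set B := pd (Jet Entr l) T z.
(* Only the entropy jet of order [l.+1] is varied, to the value [s] that gives the last argument of
   [f] the value [y]. [Psi] is unaffected and [Dr T] is affine, hence so is [f] along this line. *)
have A y : f (upd x ord_max y)
    = (Dr T z / r + Psi z) / z (Jet Dens 0)
      + B / r / z (Jet Dens 0) / w * (y - J n l.+1 z).
  pose s := z (Jet Entr l.+1) + (y - J n l.+1 z) / w.
  have Ds : jet_dom (upd z (Jet Entr l.+1) s) by apply: jet_dom_upd_entr.
  have := Dr_upd_top Entr s oT' Dz; rewrite DrT // -/B.
  have -> : Psi (upd z (Jet Entr l.+1) s) = Psi z.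
    apply: oPsi => // c ck; rewrite upd_other //; apply/eqP => cE.
    by move: ck; rewrite cE /= leqNgt kl.
  rewrite /I_density J_upd_ord // Jz !upd_other // -/w -/r.
  have -> : J n l.+1 z + w * (s - z (Jet Entr l.+1)) = y by rewrite /s; field; lra.
  have -> : s - z (Jet Entr l.+1) = (y - J n l.+1 z) / w by rewrite /s; ring.
  move=> E; apply: (Rmult_eq_reg_l (z (Jet Dens 0))); last lra.
  apply: (Rmult_eq_reg_l r); last lra.
  transitivity (r * (z (Jet Dens 0) * f (upd x ord_max y) - Psi z) + r * Psi z); first ring.
  by rewrite E; field; lra.
apply: (@pd_pd_affine _ f ord_max x
  ((Dr T z / r + Psi z) / z (Jet Dens 0) - B / r / z (Jet Dens 0) / w * J n l.+1 z)
  (B / r / z (Jet Dens 0) / w)) => y.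
by rewrite A; ring.
Qed.

(** * Smooth primitives in one coordinate *)

Section Primitive.
Variables (I : eqType) (k : I).
Implicit Types (G : (I -> R) -> R) (x : I -> R).

Definition prim G : (I -> R) -> R := fun x => RInt (fun s => G (upd x k s)) 0 (x k).

Let smooth := @smooth_on I (fun _ => True).

Lemma smooth_continuous_upd G x i s : smooth G -> continuous (fun s => G (upd x i s)) s.
Proof.
move=> sG; apply: ex_derive_continuous; eexists.
exact: (smooth_on_is_derive sG).
Qed.

Lemma smooth_ex_RInt G x i a b : smooth G -> ex_RInt (fun s => G (upd x i s)) a b.
Proof.
by move=> sG; apply: (@ex_RInt_continuous R_CompleteNormedModule) => s _;
  apply: smooth_continuous_upd.
Qed.

(** Continuity holds only pointwise along the segment; a compactness argument supplies a common
    radius. Both values are compared with the one at a nearby centre [t], whence the halved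
    [eps]. *)
Lemma uniform_on_segment G x a b (eps : posreal) : smooth G ->
  exists d : posreal, forall y, (forall i, Rabs (y i - x i) < d) ->
  forall s, a <= s <= b -> Rabs (G (upd y k s) - G (upd x k s)) < eps.
Proof.
move=> sG.
have /functional_choice [delta Hd] : forall s, exists d : posreal, forall y,
    (forall i, Rabs (y i - upd x k s i) < d) -> Rabs (G y - G (upd x k s)) < pos_div_2 eps.
  move=> s; have /continuous_coordP := smooth_on_continuous sG (z := upd x k s) Logic.I.
  exact.
have [d Hcomp] := compactness_value_1d a b delta.
exists d => y yx s /Hcomp /NNPP [t [_ [st dt]]].
have near u : (forall i, Rabs (u i - x i) < d) ->
    Rabs (G (upd u k s) - G (upd x k t)) < pos_div_2 eps.
  move=> ux; apply: Hd => i; rewrite /upd; case: eqP => _ //.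
  exact: Rlt_le_trans (ux i) dt.
have near_y := near y yx.
have near_x : Rabs (G (upd x k s) - G (upd x k t)) < pos_div_2 eps.
  by apply: near => i; rewrite Rminus_diag Rabs_R0; apply: cond_pos.
move: near_x near_y => /=; rewrite /Rabs.
by do 3!case: Rcase_abs => ?; lra.
Qed.

Lemma abs_RInt_le g a b (M : R) : ex_RInt g a b ->
  (forall s, Rmin a b <= s <= Rmax a b -> Rabs (g s) <= M) ->
  Rabs (RInt g a b) <= Rabs (b - a) * M.
Proof.
move=> ig gM.
exact: (@norm_RInt_le_const_abs R_NormedModule g a b _ M gM (RInt_correct g a b ig)).
Qed.

Lemma continuous_prim G x : smooth G -> continuous (prim G) x.
Proof.
move=> sG; apply/continuous_coordP => eps.
have e0 := cond_pos eps; have x0 := Rabs_pos (x k); have G0 := Rabs_pos (G x).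
have e1p : 0 < eps / 2 / (Rabs (x k) + 1) by apply: Rdiv_lt_0_compat; lra.
have e2p : 0 < eps / 2 / (Rabs (G x) + 1) by apply: Rdiv_lt_0_compat; lra.
have [d1 H1] := uniform_on_segment x (Rmin 0 (x k)) (Rmax 0 (x k)) (mkposreal _ e1p) sG.
have /continuous_coordP /(_ (mkposreal _ Rlt_0_1)) [d2 H2] :=
  smooth_on_continuous sG (z := x) Logic.I.
have dp : 0 < Rmin d1 (Rmin d2 (eps / 2 / (Rabs (G x) + 1))).
  by repeat apply: Rmin_glb_lt => //; apply: cond_pos.
exists (mkposreal _ dp) => y /= yx.
have yx1 i : Rabs (y i - x i) < d1 by apply: Rlt_le_trans (yx i) (Rmin_l _ _).
have yx2 i : Rabs (y i - x i) < d2.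
  apply: Rlt_le_trans (yx i) _; apply: Rle_trans (Rmin_r _ _) (Rmin_l _ _).
have yx3 : Rabs (y k - x k) < eps / 2 / (Rabs (G x) + 1).
  apply: Rlt_le_trans (yx k) _; apply: Rle_trans (Rmin_r _ _) (Rmin_r _ _).
have iy a b := smooth_ex_RInt y k a b sG.
have ix a b := smooth_ex_RInt x k a b sG.
(* The increment splits into the change of the integrand over a fixed segment and a short integral
   between the endpoints, where the integrand is at most [Rabs (G x) + 1]. The radii above make each
   part at most [eps / 2]. *)
have -> : prim G y - prim G x
    = RInt (fun s => G (upd y k s) - G (upd x k s)) 0 (x k)
      + RInt (fun s => G (upd y k s)) (x k) (y k).
  rewrite (RInt_minus (V := R_CompleteNormedModule)) // /prim.
  rewrite -(RInt_Chasles (V := R_CompleteNormedModule) _ 0 (x k) (y k)) //.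
  by rewrite /plus /minus /plus /opp /=; ring.
have A1 : Rabs (RInt (fun s => G (upd y k s) - G (upd x k s)) 0 (x k))
    <= Rabs (x k - 0) * (eps / 2 / (Rabs (x k) + 1)).
  apply: abs_RInt_le; first exact: (@ex_RInt_minus R_NormedModule).
  by move=> s sb; apply/Rlt_le/H1.
have A2 : Rabs (RInt (fun s => G (upd y k s)) (x k) (y k))
    <= Rabs (y k - x k) * (Rabs (G x) + 1).
  apply: abs_RInt_le => // s sb.
  have : Rabs (G (upd y k s) - G x) < 1.
    apply: H2 => i; rewrite /upd; case: eqP => [->|_]; last exact: yx2.
    apply: Rle_lt_trans (yx2 k); move: sb; rewrite /Rmin /Rmax /Rabs.
    by case: Rle_dec => ?; case: Rcase_abs => ?; case: Rcase_abs => ?; lra.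
  by rewrite /Rabs; do 3!case: Rcase_abs => ?; lra.
apply: Rle_lt_trans (Rabs_triang _ _) _.
have B1 : Rabs (x k - 0) * (eps / 2 / (Rabs (x k) + 1)) < eps / 2.
  rewrite Rminus_0_r.
  apply: Rlt_le_trans (_ : (Rabs (x k) + 1) * (eps / 2 / (Rabs (x k) + 1)) <= _).
    by apply: Rmult_lt_compat_r => //; lra.
  by apply: Req_le; field; lra.
have B2 : Rabs (y k - x k) * (Rabs (G x) + 1) <= eps / 2.
  apply: Rle_trans (_ : eps / 2 / (Rabs (G x) + 1) * (Rabs (G x) + 1) <= _).
    by apply: Rmult_le_compat_r; lra.
  by apply: Req_le; field; lra.
lra.
Qed.

Lemma is_derive_prim_same G x : smooth G ->
  is_derive (fun y => prim G (upd x k y)) (x k) (G x).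
Proof.
move=> sG; apply: (is_derive_ext (fun y => RInt (fun s => G (upd x k s)) 0 y)).
  by move=> y; rewrite /prim upd_same; apply: RInt_ext => s _; rewrite upd_upd.
rewrite -[X in G X](upd_id x k).
apply: (is_derive_RInt (fun s => G (upd x k s))); last exact: smooth_continuous_upd.
by apply: filter_forall => y; apply: RInt_correct; apply: smooth_ex_RInt.
Qed.

Lemma continuity_2d_upd G x i j u v : smooth G -> i != j ->
  continuity_2d_pt (fun a b => G (upd (upd x i a) j b)) u v.
Proof.
move=> sG nij eps.
have /continuous_coordP /(_ eps) [d Hd] :=
  smooth_on_continuous sG (z := upd (upd x i u) j v) Logic.I.
exists d => a b au bv; apply: Hd => m; rewrite /upd.
case: eqP => // _; case: eqP => // _.
by rewrite Rminus_diag Rabs_R0; apply: cond_pos.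
Qed.

Lemma is_derive_prim_other G x i : smooth G -> i != k ->
  is_derive (fun y => prim G (upd x i y)) (x i) (prim (pd i G) x).
Proof.
move=> sG nik.
have E y : prim G (upd x i y) = RInt (fun s => G (upd (upd x i y) k s)) 0 (x k).
  by rewrite /prim upd_other 1?eq_sym.
apply: (is_derive_ext (fun y => RInt (fun s => G (upd (upd x i y) k s)) 0 (x k))).
  by move=> y; rewrite E.
have dG u v : is_derive (fun z => G (upd (upd x i z) k v)) u
    (pd i G (upd (upd x i u) k v)).
  rewrite (updC _ _ _ nik).
  apply: (is_derive_ext (fun z => G (upd (upd x k v) i z))).
    by move=> z; rewrite (updC _ _ _ nik).
  exact: (smooth_on_is_derive sG).
have -> : prim (pd i G) x
    = RInt (fun s => Derive (fun z => G (upd (upd x i z) k s)) (x i)) 0 (x k).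
  by apply: RInt_ext => s _; rewrite (is_derive_unique _ _ _ (dG _ _)) upd_id.
apply: (is_derive_RInt_param (fun y s => G (upd (upd x i y) k s))).
- by apply: filter_forall => y s _; eexists; apply: dG.
- move=> s _.
  apply: (continuity_2d_pt_ext (fun u v => pd i G (upd (upd x i u) k v))).
    by move=> u v; rewrite (is_derive_unique _ _ _ (dG _ _)).
  by apply: continuity_2d_upd nik; apply: smooth_on_pd.
- by apply: filter_forall => y; apply: smooth_ex_RInt.
Qed.

Lemma pd_prim_same G : smooth G -> pd k (prim G) = G.
Proof.
move=> sG; apply: functional_extensionality => x.
by apply: is_derive_unique; apply: is_derive_prim_same.
Qed.

Lemma pd_prim_other G i : smooth G -> i != k -> pd i (prim G) = prim (pd i G).
Proof.
move=> sG nik; apply: functional_extensionality => x.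
by apply: is_derive_unique; apply: is_derive_prim_other.
Qed.

(** Smooth functions together with primitives of smooth functions are closed under [pd]: along [k]
    the integrand returns, along any other coordinate the derivative passes under the integral. *)
Lemma smooth_on_prim G : smooth G -> smooth (prim G).
Proof.
pose C F := smooth F \/ exists2 G, smooth G & F = prim G.
move=> sG; apply: (smooth_on_coind (C := C)); last by right; exists G.
  move=> F [sF x Dx | [G' sG' -> x _]]; first exact: (sF [::]).
  split=> [|i]; first exact: continuous_prim.
  case: (eqVneq i k) => [-> | nik]; eexists; first exact: is_derive_prim_same.
  exact: is_derive_prim_other.
move=> F i [sF | [G' sG' ->]]; first by left; apply: smooth_on_pd.
case: (eqVneq i k) => [-> | nik]; first by left; rewrite pd_prim_same.
by right; exists (pd i G'); [apply: smooth_on_pd | apply: pd_prim_other].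
Qed.

Lemma supported_prim (s : seq I) G : k \in s ->
  supported (fun _ => True) s G -> supported (fun _ => True) s (prim G).
Proof.
move=> sk supG x y _ _ xy; rewrite /prim xy //; apply: RInt_ext => t _.
by apply: supG => // i si; rewrite /upd; case: eqP => // _; apply: xy.
Qed.

End Primitive.

(** * Densities linear in the last argument are trivial *)

Lemma trivial_I_density n l (f : ('I_l.+2 -> R) -> R) :
  smooth_on (fun _ => True) f ->
  (forall x, pd ord_max (pd ord_max f) x = 0) ->
  ~ nontrivial_at_order n l.+1 (I_density n f).
Proof.
move=> sf f0; apply.
set m := ord_max in f0; set B := pd m f; pose k : 'I_l.+2 := inord l.
have kl : nat_of_ord k = l by rewrite inordK.
have km : k != m by apply/eqP => /(congr1 (@nat_of_ord _)); rewrite kl /= => /n_Sn.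
pose s := [seq i <- enum 'I_l.+2 | i != m].
have ms i : (i \in s) = (i != m) by rewrite mem_filter mem_enum andbT.
have off_m (x y : 'I_l.+2 -> R) : {in s, x =1 y} -> y = upd x m (y m).
  move=> xy; apply: functional_extensionality => i.
  by rewrite /upd; case: eqP => [-> // | /eqP im]; rewrite xy // ms.
have sB : smooth_on (fun _ => True) B := smooth_on_pd m sf.
have supB : supported (fun _ => True) s B.
  move=> x y _ _ /off_m ->; apply/esym; exact: (pd_eq0_constant _ sB).
(* [B] does not vary with the last argument, so [f] is affine in it with slope [B x]. *)
have fB x y : {in s, x =1 y} -> f x - f y = B x * (x m - y m).
  move=> xy; have dg t : is_derive (fun t => f (upd x m t) - B x * t) t 0.
    have -> : 0 = B (upd x m t) - B x.
      rewrite (supB _ x) //; first by ring.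
      by move=> i; rewrite ms => im; rewrite upd_other.
    apply: (@is_derive_minus R_AbsRing R_NormedModule); first exact: (smooth_on_is_derive sf).
    by auto_derive => //; ring.
  by have := derive0_constant (x m) (y m) dg; rewrite upd_id -off_m //; lra.
pose H := prim k B.
have sH : smooth_on (fun _ => True) H by apply: smooth_on_prim.
have supH : supported (fun _ => True) s H by apply: supported_prim; rewrite ?ms.
pose HJ z := H (fun i : 'I_l.+2 => J n i z).
have sHJ : smooth_on jet_dom HJ.
  by apply: (smooth_on_comp_fin (G := fun i : 'I_l.+2 => J n i) open_jet_dom sH) => i;
    apply: J_smooth.
have oHJ : order_le l.+1 HJ.
  move=> z y Dz Dy zy; rewrite /HJ; congr H; apply: functional_extensionality => i.
  exact: J_ord_order.
have rinv z : jet_dom z -> z Radius ^ (n - 1) <> 0.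
  by case=> z1 _; apply: pow_nonzero; lra.
have sri : smooth_on jet_dom (fun z => / z Radius ^ (n - 1)).
  by apply: (smooth_on_inv open_jet_dom) => //; apply: smooth_on_radius_pow.
(* Trivial by construction, with potential [HJ] divided by r^(n-1), so that the weight in the
   definition of triviality cancels. *)
pose Phi0 z := / z Radius ^ (n - 1) * Dr HJ z.
pose Psi z := I_density n f z + (-1) * Phi0 z.
exists Phi0, Psi; split; last by move=> z _; rewrite /Psi; ring.
  exists (fun z => / z Radius ^ (n - 1) * HJ z).
    split; first exact: (smooth_on_mult open_jet_dom).
    exists l.+1 => z y Dz Dy zy; rewrite (oHJ z y) //.
    by rewrite (zy Radius).
  move=> z Dz; rewrite (@Dr_ext _ HJ) // /Phi0.
    by field; apply: rinv.
  by move=> y Dy; field; apply: rinv.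
have sPhi0 : smooth_on jet_dom Phi0.
  apply: (smooth_on_mult open_jet_dom) => //; apply: smooth_on_Dr.
  by split; last exists l.+1.
suff oPsi : order_le l Psi.
  split; last by exists l.
  split; last by exists l.
  apply: (smooth_on_plus open_jet_dom); first exact: smooth_on_I_density.
  by apply: (smooth_on_mult open_jet_dom) => //; apply: (smooth_on_const open_jet_dom).
move=> z y Dz Dy zy.
pose rho := z (Jet Dens 0); pose X u := fun i : 'I_l.+2 => J n i u.
(* The factor r^(n-1) rho in [Dr (J n i)] cancels the weight and leaves [rho], the same factor as in
   the density. *)
have PsiE u : jet_dom u -> u (Jet Dens 0) = rho ->
    Psi u = rho * (f (X u) - Rsum (enum 'I_l.+2) (fun i => pd i H (X u) * J n i.+1 u)).
  move=> Du uE; have [u1 u2] := Du.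
  rewrite /Psi /Phi0 (Dr_comp (G := fun i : 'I_l.+2 => J n i) 
    sH _ (@J_ord_order n l.+1)) //; last first.
    by move=> i; apply: J_smooth.
  rewrite (@eq_Rsum _ _ _ (fun i => pd i H (X u) * J n i.+1 u * / inv_mass n u)); last first.
    by move=> i _; rewrite Dr_J // -/(X u) Rmult_assoc (Rmult_comm (/ _)).
  rewrite Rsum_mulr; set S := Rsum _ _.
  rewrite -[X in _ = rho * (_ - X)]/S /I_density uE -/(X u) /inv_mass uE.
  by field; split; [apply: rinv | rewrite -uE; lra].
have Xzy : {in s, X z =1 X y}.
  move=> i; rewrite ms => im; apply: (J_order n i z y Dz Dy) => c ci; apply: zy.
  apply: leq_trans ci _; have := ltn_ord i; rewrite ltnS leq_eqVlt ltnS => /orP [/eqP E|//].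
  by case/eqP: im; apply: val_inj.
rewrite !PsiE // -?(zy (Jet Dens 0)) //; congr (_ * _).
apply: Rminus_diag_uniq.
have opT := @open_true (fct_UniformSpace 'I_l.+2 R_UniformSpace).
(* Between two points agreeing through order [l] only the term [i = k] can differ: [H] does not
   depend on argument [m], and for [i < k] the function [J n i.+1] has order at most [l]. The
   remaining difference is that of [f], by [fB]. *)
suff E : Rsum (enum 'I_l.+2) (fun i => pd i H (X z) * J n i.+1 z - pd i H (X y) * J n i.+1 y)
    = B (X z) * (X z m - X y m).
  by rewrite Rsum_minus in E; have := fB _ _ Xzy; lra.
have hE i : pd i H (X y) = pd i H (X z).
  by apply/esym; apply: (supported_pd i opT supH).
rewrite (Rsum_single (a := k)) ?enum_uniq ?mem_enum // => [|i _ ik].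
  by rewrite hE /H pd_prim_same // kl Rmult_minus_distr_l.
rewrite hE; case: (eqVneq i m) => [-> | im].
  by rewrite (pd_unsupported opT supH) ?ms ?eqxx //; ring.
rewrite (J_order n i.+1 z y Dz Dy) ?Rminus_diag // => c ci; apply: zy.
apply: leq_trans ci _; have := ltn_ord i; rewrite ltnS leq_eqVlt ltnS.
case/orP => [/eqP E | ]; first by case/eqP: im; apply: val_inj.
rewrite leq_eqVlt => /orP [/eqP E|//].
by case/eqP: ik; apply: val_inj; rewrite /= kl.
Qed.

(** * Functions of (r, t) *)

(* A point (r, t) is encoded as a function on [bool], with [false] the index of [r]
   and [true] that of [t], so that [smooth_on] applies. *)
Definition pt (r t : R) : bool -> R := fun b => if b then t else r.

Definition plane (O : R * R -> Prop) (z : bool -> R) : Prop := O (z false, z true).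

Lemma pt_eta (z : bool -> R) : pt (z false) (z true) = z.
Proof. by apply: functional_extensionality => -[]. Qed.

Lemma upd_pt_false r t x : upd (pt r t) false x = pt x t.
Proof. by apply: functional_extensionality => -[]. Qed.

Lemma upd_pt_true r t x : upd (pt r t) true x = pt r x.
Proof. by apply: functional_extensionality => -[]. Qed.

Lemma open_plane O : open O -> open (plane O).
Proof.
move=> oO z /oO [e He]; exists e => y /ball_coordP H.
by apply: He; split; apply: H.
Qed.

Lemma pd_pt_false F r t : pd false F (pt r t) = Derive (fun x => F (pt x t)) r.
Proof. by rewrite /pd; apply: Derive_ext => x; rewrite upd_pt_false. Qed.

Lemma pd_pt_true F r t : pd true F (pt r t) = Derive (fun x => F (pt r x)) t.
Proof. by rewrite /pd; apply: Derive_ext => x; rewrite upd_pt_true. Qed.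

Section Plane.
Variable O : R * R -> Prop.
Hypothesis oO : open O.
Implicit Type F : (bool -> R) -> R.

(** Both partial derivatives of a [smooth_at] function are again [smooth_at], so these functions
    form a class closed under [pd]. *)
Lemma smooth_on_plane (G : R -> R -> R) :
  (forall r t, O (r, t) -> smooth_at G r t) ->
  smooth_on (plane O) (fun z => G (z false) (z true)).
Proof.
move=> sG.
pose C F := exists2 G, (forall r t, O (r, t) -> smooth_at G r t) &
  F = (fun z => G (z false) (z true)).
apply: (smooth_on_coind (C := C)); last by exists G.
  move=> _ [{sG}G sG ->] z Oz; split.
    have [/continuity_2d_pt_filterlim /filterlim_locally H _] := sG _ _ Oz 0%N.
    apply/filterlim_locally => eps; have [d Hd] := H eps.
    by exists d => y /ball_coordP yz; apply: (Hd (y false, y true)); split; apply: yz.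
  by have [_ [d1 [d2 _]]] := sG _ _ Oz 1%N; case.
move=> _ b [{sG}G sG ->]; case: b.
  exists (fun u v => Derive (fun z => G u z) v) => // r t Ort m.
  by have [_ [_ [_ [_]]]] := sG r t Ort m.+1.
exists (fun u v => Derive (fun z => G z v) u) => // r t Ort m.
by have [_ [_ [_ []]]] := sG r t Ort m.+1.
Qed.

Lemma smooth_is_derive_false F r t : smooth_on (plane O) F -> O (r, t) ->
  is_derive (fun x => F (pt x t)) r (pd false F (pt r t)).
Proof.
move=> sF Ort; have := @smooth_on_is_derive _ _ F (pt r t) false r sF.
rewrite upd_pt_false => /(_ Ort); apply: is_derive_ext => x.
by rewrite upd_pt_false.
Qed.

Lemma smooth_is_derive_true F r t : smooth_on (plane O) F -> O (r, t) ->
  is_derive (fun x => F (pt r x)) t (pd true F (pt r t)).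
Proof.
move=> sF Ort; have := @smooth_on_is_derive _ _ F (pt r t) true t sF.
rewrite upd_pt_true => /(_ Ort); apply: is_derive_ext => x.
by rewrite upd_pt_true.
Qed.

Lemma smooth_continuity_2d F r t : smooth_on (plane O) F -> O (r, t) ->
  continuity_2d_pt (fun x y => F (pt x y)) r t.
Proof.
move=> sF Ort eps.
have /continuous_coordP /(_ eps) [d Hd] := smooth_on_continuous sF (z := pt r t) Ort.
by exists d => u v ur vt; apply: Hd => -[].
Qed.

Lemma smooth_continuity_2d_swap F r t : smooth_on (plane O) F -> O (r, t) ->
  continuity_2d_pt (fun y x => F (pt x y)) t r.
Proof.
move=> sF Ort eps; have [d Hd] := smooth_continuity_2d sF Ort eps.
by exists d => u v ur vt; apply: Hd.
Qed.

Lemma locally_2d_open r t : O (r, t) -> locally_2d (fun x y => O (x, y)) r t.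
Proof. by move=> /oO Ort; apply/locally_2d_locally; apply: filter_imp Ort => -[]. Qed.

Lemma pd_pdC F z : smooth_on (plane O) F -> plane O z ->
  pd true (pd false F) z = pd false (pd true F) z.
Proof.
move=> sF; rewrite -(pt_eta z); move: (z false) (z true) => r t Ort.
have E1 : (fun u v => Derive (fun x => Derive (fun y => F (pt x y)) v) u)
    = (fun u v => pd false (pd true F) (pt u v)).
  apply: functional_extensionality => u; apply: functional_extensionality => v.
  by rewrite pd_pt_false; apply: Derive_ext => x; rewrite pd_pt_true.
have E2 : (fun u v => Derive (fun y => Derive (fun x => F (pt x y)) u) v)
    = (fun u v => pd true (pd false F) (pt u v)).
  apply: functional_extensionality => u; apply: functional_extensionality => v.
  by rewrite pd_pt_true; apply: Derive_ext => x; rewrite pd_pt_false.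
have := @Schwarz (fun x y => F (pt x y)) r t.
rewrite E1 E2.
rewrite -[Derive _ r]/((fun u v => Derive (fun x => Derive (fun y => F (pt x y)) v) u) r t) E1.
rewrite -[Derive _ t]/((fun u v => Derive (fun y => Derive (fun x => F (pt x y)) u) v) r t) E2.
move=> H; apply/esym/H.
- apply: locally_2d_impl (locally_2d_open Ort); apply: locally_2d_forall => u v Ouv.
  split; [|split; [|split]].
  + by eexists; apply: smooth_is_derive_false Ouv.
  + by eexists; apply: smooth_is_derive_true Ouv.
  + eexists; apply: (is_derive_ext (fun x => pd true F (pt x v))).
      by move=> x; rewrite pd_pt_true.
    by apply: smooth_is_derive_false Ouv; apply: smooth_on_pd.
  + eexists; apply: (is_derive_ext (fun x => pd false F (pt u x))).
      by move=> x; rewrite pd_pt_false.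
    by apply: smooth_is_derive_true Ouv; apply: smooth_on_pd.
- by apply: (smooth_continuity_2d (F := pd false (pd true F))) Ort; do 2!apply: smooth_on_pd.
- by apply: (smooth_continuity_2d (F := pd true (pd false F))) Ort; do 2!apply: smooth_on_pd.
Qed.

(** Differentiating the integral at [t] needs the integrand at nearby times and slightly beyond the
    endpoints; compactness of the segment gives a uniform margin inside [O]. *)
Lemma tube a b t : (forall r, a <= r <= b -> O (r, t)) ->
  exists e : posreal, forall r y, a - e <= r <= b + e -> Rabs (y - t) < e -> O (r, y).
Proof.
move=> Oab.
have /functional_choice [delta Hd] : forall s, exists d : posreal, a <= s <= b ->
    forall r y, Rabs (r - s) < d -> Rabs (y - t) < d -> O (r, y).
  move=> s; case: (classic (a <= s <= b)) => [sab | nsab].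
    by have [d Hd] := locally_2d_open (Oab s sab); exists d => _ r y; apply: Hd.
  by exists (mkposreal _ Rlt_0_1).
have [d Hcomp] := compactness_value_1d a b (fun s => pos_div_2 (delta s)).
(* If [b < a], the margin [(a - b) / 3] is so small that no [r] satisfies the bounds. *)
case: (Rle_dec a b) => [ab | nab]; last first.
  have ep : 0 < (a - b) / 3 by lra.
  by exists (mkposreal _ ep) => r y /= ?; lra.
exists (pos_div_2 d) => r y /= rab yt.
(* The projection of [r] to the segment. The halved radii leave room for the distance from [r] to
   [r']. *)
pose r' := Rmax a (Rmin b r).
have r'ab : a <= r' <= b.
  by split; [exact: Rmax_l | apply: Rmax_lub => //; exact: Rmin_l].
have rr' : Rabs (r - r') <= d / 2.
  have d0 := cond_pos d; move: rab; rewrite /r' /Rmax /Rmin /Rabs.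
  by case: (Rle_dec b r) => ?; case: Rle_dec => ?; case: Rcase_abs => ?; lra.
have /NNPP [s [sab [/= r's ds]]] := Hcomp r' r'ab.
have d0 := cond_pos d; have ds0 := cond_pos (delta s).
apply: (Hd s sab); last by lra.
replace (r - s) with ((r - r') + (r' - s)) by ring.
have := Rabs_triang (r - r') (r' - s); lra.
Qed.

(* Leibniz rule: with [g_t + (u g)_r = 0] the boundary terms cancel the flux. *)
Lemma conservation_law (u g : (bool -> R) -> R) (r1 r2 : R -> R) (t : R) :
  smooth_on (plane O) u -> smooth_on (plane O) g ->
  (forall z, plane O z -> pd true g z + pd false (fun y => u y * g y) z = 0) ->
  r1 t < r2 t -> (forall r, r1 t <= r <= r2 t -> O (r, t)) ->
  is_derive r1 t (u (pt (r1 t) t)) -> is_derive r2 t (u (pt (r2 t) t)) ->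
  is_derive (fun s => RInt (fun r => g (pt r s)) (r1 s) (r2 s)) t 0.
Proof.
move=> su sg law r12 Or d1 d2.
have [e He] := tube Or; have e0 := cond_pos e.
have sgt := smooth_on_pd true sg.
have sug : smooth_on (plane O) (fun y => u y * g y).
  exact: (smooth_on_mult (open_plane oO)).
have O1 : O (r1 t, t) by apply: Or; lra.
have O2 : O (r2 t, t) by apply: Or; lra.
have cont (F : (bool -> R) -> R) r y : smooth_on (plane O) F -> O (r, y) ->
    continuous (fun x => F (pt x y)) r.
  by move=> sF Ory; apply: ex_derive_continuous; eexists; apply: smooth_is_derive_false.
have near : locally t (fun y => Rabs (y - t) < e) by exists e.
have int c d y : Rabs (y - t) < e -> r1 t - e <= c <= r2 t + e ->
    r1 t - e <= d <= r2 t + e -> ex_RInt (fun r => g (pt r y)) c d.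
  move=> yt cb db; apply: (@ex_RInt_continuous R_CompleteNormedModule) => x xcd.
  apply: cont => //; apply: He => //; move: xcd; rewrite /Rmin /Rmax.
  by case: Rle_dec => ?; lra.
have E : (fun y r => Derive (fun s => g (pt r s)) y) = (fun y r => pd true g (pt r y)).
  apply: functional_extensionality => y; apply: functional_extensionality => r.
  by rewrite pd_pt_true.
have loc r : O (r, t) -> locally_2d (fun y x => continuity_2d_pt
    (fun y r => Derive (fun s => g (pt r s)) y) y x) t r.
  move=> /locally_2d_open [d Hd]; exists d => y x yt xr; rewrite E.
  by apply: smooth_continuity_2d_swap => //; apply: Hd.
have := @is_derive_RInt_param_bound_comp (fun s r => g (pt r s)) r1 r2 t _ _
  _ _ _ d1 d2 _ _ (loc _ O1) (loc _ O2) _ _.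
have -> : RInt (fun r => Derive (fun s => g (pt r s)) t) (r1 t) (r2 t)
    = - (u (pt (r2 t) t) * g (pt (r2 t) t) - u (pt (r1 t) t) * g (pt (r1 t) t)).
  apply: is_RInt_unique.
  apply: (is_RInt_ext (fun r => opp (pd false (fun y => u y * g y) (pt r t)))).
    move=> r; rewrite Rmin_left ?Rmax_right; try lra; move=> rb.
    have Ort : plane O (pt r t) by apply: (Or r); lra.
    rewrite -pd_pt_true; transitivity (- pd false (fun y => u y * g y) (pt r t)) => //.
    by apply/esym/Rplus_opp_r_uniq; rewrite Rplus_comm; apply: law.
  apply: (@is_RInt_opp R_NormedModule).
  apply: (@is_RInt_derive R_CompleteNormedModule
    (fun r => u (pt r t) * g (pt r t))) => r;
    rewrite Rmin_left ?Rmax_right; try lra; move=> rb.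
    by apply: (smooth_is_derive_false sug); apply: Or.
  by apply: cont; [apply: smooth_on_pd | apply: Or].
set D := (X in is_derive _ _ X); have -> : D = 0 by rewrite /D; ring.
apply.
- by apply: filter_imp near => y yt; apply: int => //; lra.
- by exists (pos_div_2 e) => /=; apply: filter_imp near => y yt; apply: int => //; lra.
- by exists (pos_div_2 e) => /=; apply: filter_imp near => y yt; apply: int => //; lra.
- exists (pos_div_2 e) => /=; apply: filter_imp near => y yt r.
  rewrite Rmin_left ?Rmax_right; try lra; move=> rb.
  by eexists; apply: smooth_is_derive_true sg _; apply: He => //; lra.
- move=> r; rewrite Rmin_left ?Rmax_right; try lra; move=> rb.
  by rewrite E; apply: smooth_continuity_2d_swap => //; apply: Or.
- by apply/continuity_pt_filterlim; apply: cont.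
- by apply/continuity_pt_filterlim; apply: cont.
Qed.

End Plane.

(** * The densities along a solution *)

Section Solution.
Variables (n : nat) (p : R -> R -> R) (O : R * R -> Prop) (U rho S : R -> R -> R).
Hypotheses (n0 : (0 < n)%N) (sol : radial_euler n p O U rho S).

Let oO : open O := sol.1.
Let oW : open (plane O) := open_plane oO.

Definition jet_pt (z : bool -> R) : jet_point := jet U rho S (z false) (z true).

Lemma jet_pt_dom z : plane O z -> jet_dom (jet_pt z).
Proof. by move=> /sol.2 [[]]. Qed.

Lemma smooth_Derive_n (G : R -> R -> R) k :
  (forall r t, O (r, t) -> smooth_at G r t) ->
  forall r t, O (r, t) -> smooth_at (fun r t => Derive_n (fun x => G x t) k r) r t.
Proof.
move=> sG; elim: k => [//|k IH] r t Ort m.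
by have [_ [_ [_ []]]] := IH r t Ort m.+1.
Qed.

Lemma smooth_jet_pt c : smooth_on (plane O) (fun z => jet_pt z c).
Proof.
case: c => [||v k]; try exact: (smooth_on_coord oW).
by case: v; apply: (@smooth_on_plane _
    (fun r t => Derive_n (fun x => _ x t) k r)) => r t Ort;
  apply: smooth_Derive_n => // x y /sol.2 [[_ _ []]].
Qed.

Lemma smooth_comp_jet N Phi : smooth_on jet_dom Phi -> order_le N Phi ->
  smooth_on (plane O) (fun z => Phi (jet_pt z)).
Proof.
move=> sP /order_leP oP.
apply: (smooth_on_comp oW open_jet_dom (uniq_coords N) sP oP
  (G := fun c z => jet_pt z c)); first exact: smooth_jet_pt.
exact: jet_pt_dom.
Qed.

(** Along a solution the r-derivative of every jet coordinate is its [shift], so the chain rule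
    reproduces [Dr]. *)
Lemma pd_comp_jet N Phi z : smooth_on jet_dom Phi -> order_le N Phi -> plane O z ->
  pd false (fun y => Phi (jet_pt y)) z = Dr Phi (jet_pt z).
Proof.
move=> sP oP Oz; rewrite (Dr_Rsum oP); last exact: jet_pt_dom.
move/order_leP in oP.
rewrite (pd_comp oW open_jet_dom (uniq_coords N) false sP oP
  (G := fun c z => jet_pt z c) smooth_jet_pt jet_pt_dom Oz).
apply: eq_Rsum => c _; congr (_ * _).
case: c => [||[] k] //=; rewrite /pd /=.
- by rewrite Derive_const.
- by rewrite Derive_id.
Qed.

Let u z := U (z false) (z true).
Let mass z := z false ^ (n - 1) * rho (z false) (z true).
Let j i z := J n i (jet_pt z).

Let su : smooth_on (plane O) u.
Proof. exact: (smooth_jet_pt (Jet Vel 0)). Qed.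

Let smass : smooth_on (plane O) mass.
Proof.
apply: (smooth_on_mult oW (F := fun z => z false ^ (n - 1))).
  by apply: (smooth_on_pow oW); apply: (smooth_on_coord oW).
exact: (smooth_jet_pt (Jet Dens 0)).
Qed.

Let sj i : smooth_on (plane O) (j i).
Proof. exact: smooth_comp_jet (J_smooth n i) (J_order n i). Qed.

Let sumass : smooth_on (plane O) (fun z => u z * mass z).
Proof. exact: (smooth_on_mult oW). Qed.

Lemma pd_j i z : plane O z -> pd false (j i) z = mass z * j i.+1 z.
Proof.
move=> Oz; rewrite (pd_comp_jet (J_smooth n i) (J_order n i)) // Dr_J; last exact: jet_pt_dom.
congr (_ * _); rewrite /inv_mass /mass /=.
have [[r0 rho0 _] _] := sol.2 _ _ Oz.
by field; split; try apply: pow_nonzero; lra.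
Qed.

(** This is the continuity equation times r^(n-1): the geometric term (n-1)/r is the logarithmic
    derivative of the weight. *)
Lemma mass_conservation z : plane O z ->
  pd true mass z + pd false (fun y => u y * mass y) z = 0.
Proof.
rewrite -(pt_eta z); move: (z false) (z true) => r t; rewrite /plane /= => Ort.
have [[r0 rho0 _] [_ eq_rho _]] := sol.2 _ _ Ort.
have dU := smooth_is_derive_false su Ort.
have drho := smooth_is_derive_false (smooth_jet_pt (Jet Dens 0)) Ort.
have -> : pd true mass (pt r t) = r ^ (n - 1) * Derive (fun t' => rho r t') t.
  by rewrite pd_pt_true /mass /= Derive_scal.
rewrite pd_pt_false /u /mass /=.
have dUrho : ex_derive (fun x => U x t * rho x t) r.
  by apply: ex_derive_mult; eexists; [exact: dU | exact: drho].
rewrite (Derive_ext (fun x => U x t * _) (fun x => x ^ (n - 1) * (U x t * rho x t)));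
  last by move=> x; ring.
rewrite Derive_mult //; last by auto_derive.
have -> : Derive (fun x => x ^ (n - 1)) r = r ^ (n - 1) * ((INR n - 1) / r).
  apply: is_derive_unique; auto_derive => //.
  case: n n0 => // k _; rewrite subSS subn0 S_INR.
  (* For exponent 0, that is [n = 1], the predecessor of the exponent is truncated, but both sides
     vanish. *)
  case: k => [|k]; first by rewrite /=; field; lra.
  by rewrite [r ^ k.+1]/=; simpl predn; field; lra.
replace (_ + _) with (r ^ (n - 1) * (Derive (fun t' => rho r t') t
   + Derive (fun r' => U r' t * rho r' t) r + (INR n - 1) / r * (U r t * rho r t))) by ring.
by rewrite eq_rho Rmult_0_r.
Qed.

(** With m for [mass], (j_i)_r = m j_(i+1). Differentiating the transport law of j_i in r and
    exchanging the mixed derivatives gives (m j_(i+1))_t + (u m j_(i+1))_r = 0. Subtracting j_(i+1)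
    times mass conservation leaves m times the next transport law, and m > 0. *)
Lemma j_transported i z : plane O z -> pd true (j i) z + u z * pd false (j i) z = 0.
Proof.
elim: i z => [|i IH] z Oz.
  by have [_ [_ _]] := sol.2 _ _ Oz.
have [[r0 rho0 _] _] := sol.2 _ _ Oz.
have m0 : 0 < mass z by apply: Rmult_lt_0_compat => //; apply: pow_lt.
have E1 : pd true (pd false (j i)) z
    = pd true mass z * j i.+1 z + mass z * pd true (j i.+1) z.
  by rewrite (pd_ext_loc true oW (@pd_j i) Oz) (pd_mult true smass (sj i.+1) Oz).
have E2 : pd false (pd true (j i)) z
    + (pd false (fun y => u y * mass y) z * j i.+1 z
       + (u z * mass z) * pd false (j i.+1) z) = 0.
  rewrite -(pd_mult false sumass (sj i.+1) Oz).
  rewrite -(pd_plus false (smooth_on_pd true (sj i)) (smooth_on_mult oW sumass (sj i.+1)) Oz).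
  rewrite (@pd_ext_loc _ _ _ (fun _ => 0) z false oW) //; first by rewrite /pd Derive_const.
  by move=> y Oy; rewrite -(IH y Oy) pd_j //; ring.
have := pd_pdC oO (sj i) Oz; have := mass_conservation Oz; rewrite E1 => Em E3.
apply: (Rmult_eq_reg_l (mass z)); last lra.
replace (mass z * _) with (mass z * pd true (j i.+1) z
  + (u z * mass z) * pd false (j i.+1) z) by ring.
have EX : pd false (fun y => u y * mass y) z = - pd true mass z by lra.
rewrite EX -E3 in E2; lra.
Qed.

Lemma I_density_conserved l (f : ('I_l.+1 -> R) -> R) (a b : R) (r1 r2 : R -> R) :
  smooth_on (fun _ => True) f -> transported O U a b r1 r2 ->
  forall t, a < t < b ->
  is_derive (fun t' => RInt (fun r => I_density n f (jet U rho S r t') * r ^ (n - 1))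
                            (r1 t') (r2 t')) t 0.
Proof.
move=> sf tr t /tr [r12 Or d1 d2].
pose F z := f (fun i : 'I_l.+1 => j i z).
have sF : smooth_on (plane O) F.
  by apply: (smooth_on_comp_fin (G := fun i : 'I_l.+1 => j i) oW sf) => i; apply: sj.
have dF b' z : plane O z -> pd b' F z
    = Rsum (enum 'I_l.+1) (fun i => pd i f (fun k => j k z) * pd b' (j i) z).
  move=> Oz; exact: (pd_comp oW open_true (enum_uniq 'I_l.+1) b' sf
    (@supported_enum _ _ _) (G := fun i : 'I_l.+1 => j i)).
have F_transported z : plane O z -> pd true F z + u z * pd false F z = 0.
  move=> Oz; rewrite !dF // Rmult_comm -Rsum_mulr -Rsum_plus.
  apply: Rsum_eq0 => i _.
  transitivity (pd i f (fun k => j k z) * (pd true (j i) z + u z * pd false (j i) z)).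
    by ring.
  by rewrite j_transported // Rmult_0_r.
pose g z := mass z * F z.
apply: (is_derive_ext (fun s => RInt (fun r => g (pt r s)) (r1 s) (r2 s))).
  move=> s; apply: RInt_ext => r _.
  by rewrite /g /mass /F /j /I_density /jet_pt /=; ring.
have sg : smooth_on (plane O) g by apply: (smooth_on_mult oW).
apply: (conservation_law oO su sg _ r12 Or d1 d2) => z Oz.
rewrite (@pd_ext_loc _ _ (fun y => u y * g y) (fun y => (u y * mass y) * F y) z false oW) //;
  last by move=> y _; rewrite /g; ring.
rewrite (pd_mult true smass sF Oz) (pd_mult false sumass sF Oz).
have := mass_conservation Oz; have := F_transported _ Oz => E1 E2.
(* The goal is [F z] times mass conservation plus [mass z] times the transport law of [F]. *)
nra.
Qed.

End Solution.

Unset Implicit Arguments.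
Set Strict Implicit.
Set Printing Implicit Defensive.

Theorem theorem4p2 (n : nat) (hn : (1 < n)%nat)
    (p : R -> R -> R) (hp : equation_of_state p)
    (l : nat) (hl : (1 <= l)%nat)
    (f : ('I_l.+1 -> R) -> R) (hf : smooth_on (fun _ => True) f) :
  ((exists (x : 'I_l.+1 -> R) (y : R), f (upd x ord_max y) <> f x) ->
     integral_invariant n p (I_density n f) /\ has_order l (I_density n f))
  /\
  (nontrivial_at_order n l (I_density n f) <->
   exists x : 'I_l.+1 -> R, pd ord_max (pd ord_max f) x <> 0).
Proof.
split=> [f_dep|].
  split; last exact: has_order_I_density.
  split; first exact: differential_I_density.
  move=> O U rho S sol a b r1 r2; apply: (I_density_conserved (ltnW hn) sol hf).
(* Writing [l] as [m.+1] makes an argument before the last one available. *)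
case: l hl f hf => // m _ f hf; split; last exact: nontrivial_I_density.
move=> nontriv; apply: NNPP => no; apply: (trivial_I_density hf) nontriv => x.
by apply: NNPP => fx; apply: no; exists x.
Qed.
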